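(* Let $p,q:[a,\infty)\to(0,\infty)$ be continuous, $a\ge 0$, and consider the equation (A): $(p(t)x')'=q(t)x$. Assume that $\int_a^\infty \frac{dt}{p(t)}=\infty$. Put $P(t)=\int_a^t\frac{ds}{p(s)}$ and $\rho(t)=\int_t^\infty q(s)\,ds$. Then all solutions of (A) are moderate if and only if $$\int_a^\infty q(t)P(t)\,dt<\infty\qquad\Bigl(\text{or equivalently } \int_a^\infty\frac{\rho(t)}{p(t)}\,dt<\infty\Bigr).$$ In this case (A) has a moderate basis consisting of solutions $x_1(t)$ and $x_2(t)$ which are reproduced from global solutions of (R1) (or (R2)) and satisfy, as $t\to\infty$, $$x_1(t)\sim 1,\quad Dx_1(t)\sim-\rho(t),$$ $$x_2(t)\sim P(t),\quad Dx_2(t)\sim 1.$$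
   Context: Solutions of (A) are nontrivial real solutions defined on some interval $[T,\infty)$, $T\ge a$. The quasi-derivative of $x$ is $Dx(t)=p(t)x'(t)$. For every solution $x$ of (A) the limits $x(\infty)=\lim_{t\to\infty}x(t)$ and $Dx(\infty)=\lim_{t\to\infty}Dx(t)$ exist in the extended reals; the pair $(x(\infty),Dx(\infty))$ is the terminal state of $x$. When $\int_a^\infty dt/p(t)=\infty$, a solution $x$ is called moderate if its terminal state satisfies either $|x(\infty)|=\infty$ and $0<|Dx(\infty)|<\infty$, or $0<|x(\infty)|<\infty$ and $Dx(\infty)=0$. A moderate basis is a basis of the two-dimensional solution space of (A) consisting of two moderate solutions. If $\int_a^\infty q(t)\,dt=\infty$, then $\rho\equiv+\infty$ and the condition $\int_a^\infty\rho/p\,dt<\infty$ is understood to fail. The Riccati equations associated with (A) are (R1) $u'=q(t)-\frac{u^2}{p(t)}$ and (R2) $v'=\frac1{p(t)}-q(t)v^2$. A global solution is a solution existing on some interval $[T,\infty)$. A solution $x$ of (A) is reproduced from a global solution $u$ of (R1) if, up to a nonzero constant factor, for all large $t$, $x(t)=\exp\bigl(\int_T^t\frac{u(s)}{p(s)}ds\bigr)$ or $x(t)=\exp\bigl(-\int_t^\infty\frac{u(s)}{p(s)}ds\bigr)$ (according as the improper integral diverges or converges), or $x(t)=\frac1{u(t)}\exp\bigl(\int_T^t\frac{q(s)}{u(s)}ds\bigr)$ or $x(t)=\frac1{u(t)}\exp\bigl(-\int_t^\infty\frac{q(s)}{u(s)}ds\bigr)$ (with $u\ne0$, same convention). It is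 reproduced from a global solution $v\neq 0$ of (R2) if, up to a nonzero constant factor, $x(t)=\exp\bigl(\int_T^t\frac{ds}{p(s)v(s)}\bigr)$ or $x(t)=\exp\bigl(-\int_t^\infty\frac{ds}{p(s)v(s)}\bigr)$, or $x(t)=v(t)\exp\bigl(\int_T^tq(s)v(s)ds\bigr)$ or $x(t)=v(t)\exp\bigl(-\int_t^\infty q(s)v(s)ds\bigr)$ (same convention). $f(t)\sim g(t)$ as $t\to\infty$ means $\lim_{t\to\infty}f(t)/g(t)=1$. *)

(* Defs.v *)
From Stdlib Require Import Reals.
From Coquelicot Require Import Coquelicot.

Open Scope R_scope.

(** Functions on [[T, oo)] are total functions [R -> R] of which only the values
    on [[T, oo)] are used.  [is_derive_from T f t l] is [is_derive f t l]
    relative to [[T, oo)]: two-sided for [t > T], right derivative at [t = T]. *)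
Definition is_derive_from (T : R) (f : R -> R) (t l : R) : Prop :=
  filterdiff f (within (fun s => T <= s) (locally t)) (fun h : R => scal h l).

(** For the nonnegative integrands [q * P] and [rho / p] this says that the
    improper integral is finite. *)
Definition integrable_at_infty (f : R -> R) (a : R) : Prop :=
  ex_RInt_gen f (at_point a) (Rbar_locally p_infty).

Definition int_to_infty (f : R -> R) (t : R) : R :=
  RInt_gen f (at_point t) (Rbar_locally p_infty).

Definition Pint (p : R -> R) (a t : R) : R := RInt (fun s => / p s) a t.

(** A meaningful value only when [q] is integrable at infinity. *)
Definition rho (q : R -> R) (t : R) : R := int_to_infty q t.

(** The first conjunct encodes the convention that the condition fails when
    [rho] is identically infinite. *)
Definition rho_condition (p q : R -> R) (a : R) : Prop :=
  integrable_at_infty q a /\ integrable_at_infty (fun t => rho q t / p t) a.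

Definition quasi_derivative (p : R -> R) (T : R) (x Dx : R -> R) : Prop :=
  forall t, T <= t -> exists l, is_derive_from T x t l /\ Dx t = p t * l.

(** [(p x')' = q x] on [[T, oo)], the zero solution being allowed. *)
Definition solves (p q : R -> R) (T : R) (x Dx : R -> R) : Prop :=
  quasi_derivative p T x Dx /\
  forall t, T <= t -> is_derive_from T Dx t (q t * x t).

Definition solution (p q : R -> R) (T : R) (x Dx : R -> R) : Prop :=
  solves p q T x Dx /\ exists t, T <= t /\ x t <> 0.

Definition terminal_state (x Dx : R -> R) (lx lD : Rbar) : Prop :=
  is_lim x p_infty lx /\ is_lim Dx p_infty lD.

Definition finite_nonzero (l : Rbar) : Prop :=
  Rbar_lt (Finite 0) (Rbar_abs l) /\ Rbar_lt (Rbar_abs l) p_infty.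

(** The notion appropriate to the case where [1 / p] is not integrable at
    infinity. *)
Definition moderate (x Dx : R -> R) : Prop :=
  exists lx lD : Rbar, terminal_state x Dx lx lD /\
    ((Rbar_abs lx = p_infty /\ finite_nonzero lD) \/
     (finite_nonzero lx /\ lD = Finite 0)).

Definition all_solutions_moderate (p q : R -> R) (a : R) : Prop :=
  forall (T : R) (x Dx : R -> R),
    a <= T -> solution p q T x Dx -> moderate x Dx.

(** A solution may be given on any [[T, oo)] with [a <= T]; spanning and
    independence are therefore required for the restrictions to each of these
    intervals. *)
Definition solution_basis (p q : R -> R) (a : R)
    (x1 Dx1 x2 Dx2 : R -> R) : Prop :=
  solution p q a x1 Dx1 /\ solution p q a x2 Dx2 /\
  forall T, a <= T ->
    (forall c1 c2 : R,
       (forall t, T <= t -> c1 * x1 t + c2 * x2 t = 0) -> c1 = 0 /\ c2 = 0) /\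
    (forall x Dx : R -> R, solves p q T x Dx ->
       exists c1 c2 : R, forall t, T <= t -> x t = c1 * x1 t + c2 * x2 t).

Definition moderate_basis (p q : R -> R) (a : R)
    (x1 Dx1 x2 Dx2 : R -> R) : Prop :=
  solution_basis p q a x1 Dx1 x2 Dx2 /\ moderate x1 Dx1 /\ moderate x2 Dx2.

Definition riccati1 (p q : R -> R) (T : R) (u : R -> R) : Prop :=
  forall t, T <= t -> is_derive_from T u t (q t - (u t) ^ 2 / p t).

Definition riccati2 (p q : R -> R) (T : R) (v : R -> R) : Prop :=
  forall t, T <= t -> is_derive_from T v t (/ p t - q t * (v t) ^ 2).

(** Up to a nonzero constant factor and for all large [t], [x] is [g] times
    [exp] of the primitive of [f] normalised at [S] if the improper integral of
    [f] diverges, and at infinity if it converges. *)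
Definition represented (x g f : R -> R) (S : R) : Prop :=
  exists c : R, c <> 0 /\
    ((~ integrable_at_infty f S /\
      Rbar_locally p_infty (fun t => x t = c * (g t * exp (RInt f S t)))) \/
     (integrable_at_infty f S /\
      Rbar_locally p_infty (fun t => x t = c * (g t * exp (- int_to_infty f t))))).

Definition reproduced_from_R1 (p q : R -> R) (a : R) (x : R -> R) : Prop :=
  exists (T : R) (u : R -> R), a <= T /\ riccati1 p q T u /\
    (represented x (fun _ => 1) (fun s => u s / p s) T \/
     ((forall t, T <= t -> u t <> 0) /\
      represented x (fun t => / u t) (fun s => q s / u s) T)).

Definition reproduced_from_R2 (p q : R -> R) (a : R) (x : R -> R) : Prop :=
  exists (T : R) (v : R -> R), a <= T /\ riccati2 p q T v /\
    (forall t, T <= t -> v t <> 0) /\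
    (represented x (fun _ => 1) (fun s => / (p s * v s)) T \/
     represented x v (fun s => q s * v s) T).

Definition asymp (f g : R -> R) : Prop :=
  is_lim (fun t => f t / g t) p_infty (Finite 1).

(* Main.v *)
Require Import Defs.
From Stdlib Require Import Reals Lra Lia Classical.
From Coquelicot Require Import Coquelicot.
Open Scope R_scope.

(** Write the equation as the system [x' = z / p], [z' = q x], with [z] the
    quasi-derivative, and let [P], [Q], [G] be primitives of [1 / p], [q],
    [q P], with [P] vanishing at [a].  Since [q P] is nonnegative, its integral
    converges exactly when [G] is bounded.

    There is a solution with [x >= 1] and [z >= 1] on [[a, oo)]
    ([exists_growing_flow]).  Then [x' >= 1 / p], so [x >= P] tends to infinity,
    and [z' = q x >= q P].  If this solution is moderate then [z] has a finite
    limit, and [z] dominates [G]; so the integral condition holds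
    ([integral_qP_of_all_moderate]).

    Conversely let [G] be bounded.  Then so is [Q], because [P >= 1] eventually.
    As [z] increases, [x <= x(a) + z P]; inserted in [z' = q x] and divided by
    [z >= 1] this gives [(ln z)' <= x(a) q + q P], whence [z] has a finite limit
    [m >= 1].  Dividing by [m] yields [x2] with [Dx2 -> 1], and [x2 ~ P] by
    L'Hopital's rule ([exists_dominant_flow]).  Reduction of order yields the
    second solution [x1(t) = x2(t) * int_t^oo 1 / (p x2^2)]; L'Hopital's rule
    again, against [1 / x2] and against [rho], shows that [x1 -> 1] and
    [Dx1 ~ - rho] ([exists_recessive_flow],
    [recessive_quasi_derivative_asymp]).  The Wronskian of the pair is [1], and
    the constancy of Wronskians writes every solution as a combination of [x1]
    and [x2], Cramer's rule providing the coefficients ([solves_span]); the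
    limits of the two solutions then show that each nontrivial combination is
    moderate ([moderate_of_combination]).

    The two integral conditions are compared by integrating by parts,
    [int q P = int rho / p - rho P], where
    [0 <= rho(t) P(t) <= int_t^oo q P] ([integral_qP_iff_rho_condition]).
    Finally [u = Dx / x] and [v = x / Dx] solve the two Riccati equations, and
    [u / p = 1 / (p v)] is the derivative of [ln x]; both [x1] and [x2] are
    positive with quasi-derivatives of constant sign on the whole of
    [[a, oo)]. *)

(** * Functions with a prescribed derivative on a half-line *)

(** The derivative is two-sided also at [a]: the values of [F] just to the left
    of [a] take part, which leaves ordinary calculus available on the closed
    half-line. *)
Definition derives_on (a : R) (F f : R -> R) : Prop :=
  forall t, a <= t -> is_derive F t (f t).

(** Continuation of [f] by the constant [f a] to the left of [a]: it turns
    one-sided continuity at [a] into continuity on the line. *)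
Lemma continuous_on_Rmax (a : R) (f : R -> R) :
  continuous_on (fun t => a <= t) f ->
  forall t, continuous (fun s => f (Rmax a s)) t.
Proof.
intros Hf t.
apply (filterlim_comp _ _ _ (fun s => Rmax a s) f _
         (within (fun s => a <= s) (locally (Rmax a t)))).
- intros P HP.
  assert (Hc : continuous (Rmax a) t).
  { apply continuous_ext with (fun s => (a + s + Rabs (a - s)) / 2).
    { intros s; unfold Rmax, Rabs.
      destruct (Rle_dec a s); destruct (Rcase_abs (a - s)); lra. }
    apply (continuous_mult (fun s => a + s + Rabs (a - s)) (fun _ => / 2));
      [|apply continuous_const].
    apply (continuous_plus (fun s => a + s) (fun s => Rabs (a - s))).
    - apply (continuous_plus (fun _ => a) (fun s => s));
        [apply continuous_const | apply continuous_id].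
    - apply (continuous_comp (fun s => a - s) Rabs);
        [|apply continuous_Rabs].
      apply (continuous_minus (fun _ => a) (fun s => s));
        [apply continuous_const | apply continuous_id]. }
  generalize (Hc _ HP); unfold filtermap; apply filter_imp.
  intros s Hs; apply Hs, Rmax_l.
- apply Hf, Rmax_l.
Qed.

Lemma Rmax_continuous_on (a : R) (f : R -> R) :
  (forall t, continuous (fun s => f (Rmax a s)) t) ->
  continuous_on (fun t => a <= t) f.
Proof.
intros Hf.
apply continuous_on_ext with (fun s => f (Rmax a s)).
- intros t Ht; now rewrite Rmax_right.
- apply continuous_on_forall; intros t _; apply Hf.
Qed.

Lemma continuous_on_mult (a : R) (f g : R -> R) :
  continuous_on (fun t => a <= t) f -> continuous_on (fun t => a <= t) g ->
  continuous_on (fun t => a <= t) (fun t => f t * g t).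
Proof.
intros Hf Hg; apply Rmax_continuous_on; intros t.
apply (continuous_mult (fun s => f (Rmax a s)) (fun s => g (Rmax a s)));
  now apply continuous_on_Rmax.
Qed.

Lemma continuous_on_inv (a : R) (f : R -> R) :
  continuous_on (fun t => a <= t) f -> (forall t, a <= t -> f t <> 0) ->
  continuous_on (fun t => a <= t) (fun t => / f t).
Proof.
intros Hf Hf0; apply Rmax_continuous_on; intros t.
apply continuous_comp with (f := fun s => f (Rmax a s)) (g := Rinv).
- now apply continuous_on_Rmax.
- apply continuous_Rinv, Hf0, Rmax_l.
Qed.

Lemma derives_on_continuous (a : R) (F f : R -> R) :
  derives_on a F f -> continuous_on (fun t => a <= t) F.
Proof.
intros HF; apply continuous_on_forall; intros t Ht.
apply (ex_derive_continuous F); exists (f t); now apply HF.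
Qed.

Lemma exists_primitive (a : R) (f : R -> R) :
  continuous_on (fun t => a <= t) f -> exists F, derives_on a F f.
Proof.
intros Hf; exists (RInt (fun s => f (Rmax a s)) a); intros t Ht.
replace (f t) with (f (Rmax a t)) by now rewrite Rmax_right.
apply (is_derive_RInt (fun s => f (Rmax a s)) _ a).
- exists (mkposreal 1 Rlt_0_1); intros s _.
  apply (RInt_correct (V := R_CompleteNormedModule)).
  apply (ex_RInt_continuous (V := R_CompleteNormedModule)).
  intros; now apply (continuous_on_Rmax a f).
- now apply (continuous_on_Rmax a f).
Qed.

Lemma is_RInt_primitive (a : R) (F f : R -> R) (s t : R) :
  continuous_on (fun t => a <= t) f -> derives_on a F f ->
  a <= s -> a <= t -> is_RInt f s t (F t - F s).
Proof.
intros Hf HF Hs Ht.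
assert (Hm : a <= Rmin s t) by now apply Rmin_glb.
apply is_RInt_ext with (fun r => f (Rmax a r)).
{ intros r Hr; rewrite Rmax_right; lra. }
apply (is_RInt_derive F (fun r => f (Rmax a r))).
- intros r Hr; rewrite Rmax_right by lra; apply HF; lra.
- intros r _; now apply (continuous_on_Rmax a f).
Qed.

Lemma derives_on_mean (a : R) (F f : R -> R) (s t : R) :
  derives_on a F f -> a <= s <= t ->
  exists c, s <= c <= t /\ F t - F s = f c * (t - s).
Proof.
intros HF Hst.
destruct (MVT_gen F s t f) as [c Hc].
- intros x; rewrite Rmin_left, Rmax_right by lra; intros; apply HF; lra.
- intros x; rewrite Rmin_left, Rmax_right by lra; intros.
  apply continuity_pt_filterlim, (ex_derive_continuous F).
  exists (f x); apply HF; lra.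
- rewrite Rmin_left, Rmax_right in Hc by lra; now exists c.
Qed.

Lemma derives_on_incr (a : R) (F f : R -> R) (s t : R) :
  derives_on a F f -> (forall r, a <= r -> 0 <= f r) ->
  a <= s <= t -> F s <= F t.
Proof.
intros HF Hf Hst; destruct (derives_on_mean a F f s t HF Hst) as [c [Hc E]].
assert (0 <= f c * (t - s)) by (apply Rmult_le_pos; [apply Hf|]; lra).
lra.
Qed.

Lemma derives_on_strict_incr (a : R) (F f : R -> R) (s t : R) :
  derives_on a F f -> (forall r, a <= r -> 0 < f r) ->
  a <= s < t -> F s < F t.
Proof.
intros HF Hf Hst.
destruct (derives_on_mean a F f s t HF) as [c [Hc E]]; [lra|].
assert (0 < f c * (t - s)) by (apply Rmult_lt_0_compat; [apply Hf|]; lra).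
lra.
Qed.

Lemma derives_on_minus (a : R) (F f G g : R -> R) :
  derives_on a F f -> derives_on a G g ->
  derives_on a (fun t => F t - G t) (fun t => f t - g t).
Proof. intros HF HG t Ht; apply (is_derive_minus F G); auto. Qed.

Lemma derives_on_le (a : R) (F f G g : R -> R) (s t : R) :
  derives_on a F f -> derives_on a G g ->
  (forall r, a <= r -> f r <= g r) -> a <= s <= t -> F t - F s <= G t - G s.
Proof.
intros HF HG Hfg Hst.
generalize (derives_on_incr a _ _ s t (derives_on_minus a G g F f HG HF)); simpl.
intros H; cut (G s - F s <= G t - F t); [lra|].
apply H; auto; intros r Hr; generalize (Hfg r Hr); lra.
Qed.

Lemma derives_on_ext (a : R) (F f g : R -> R) :
  (forall t, a <= t -> f t = g t) -> derives_on a F f -> derives_on a F g.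
Proof. intros E HF t Ht; rewrite <- E by easy; auto. Qed.

Lemma derives_on_weaken (a b : R) (F f : R -> R) :
  a <= b -> derives_on a F f -> derives_on b F f.
Proof. intros Hab HF t Ht; apply HF; lra. Qed.

(** * Limits at infinity *)

Lemma eventually_ge (M : R) : Rbar_locally p_infty (fun t => M <= t).
Proof. exists M; intros; lra. Qed.

Lemma is_lim_bounded_incr (a B : R) (F f : R -> R) :
  derives_on a F f -> (forall r, a <= r -> 0 <= f r) ->
  (forall t, a <= t -> F t <= B) ->
  exists l : R, is_lim F p_infty l.
Proof.
intros HF Hf HB.
destruct (completeness (fun y => exists t, a <= t /\ y = F t)) as [l [Hub Hl]].
- exists B; intros y [t [Ht ->]]; auto.
- exists (F a), a; split; [lra | easy].
- exists l; apply is_lim_spec; intros eps.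
  destruct (classic (exists t, a <= t /\ l - eps < F t)) as [[t [Ht Hlt]]|Hn].
  + exists t; intros s Hs.
    assert (F t <= F s) by (apply (derives_on_incr a F f); auto; lra).
    assert (F s <= l) by (apply Hub; exists s; split; [lra | easy]).
    apply Rabs_def1; generalize (cond_pos eps); lra.
  + exfalso; cut (l <= l - eps); [generalize (cond_pos eps); lra|].
    apply Hl; intros y [t [Ht ->]].
    apply Rnot_lt_le; intros H; apply Hn; now exists t.
Qed.

Lemma is_lim_le_bound (f : R -> R) (l M : R) :
  is_lim f p_infty l -> Rbar_locally p_infty (fun t => f t <= M) -> l <= M.
Proof.
intros Hf HM.
assert (H : Rbar_le l M); [|exact H].
apply (is_lim_le_loc f (fun _ => M) p_infty l M HM Hf (is_lim_const M p_infty)).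
Qed.

Lemma is_lim_ge_bound (f : R -> R) (l M : R) :
  is_lim f p_infty l -> Rbar_locally p_infty (fun t => M <= f t) -> M <= l.
Proof.
intros Hf HM.
assert (H : Rbar_le M l); [|exact H].
apply (is_lim_le_loc (fun _ => M) f p_infty M l HM (is_lim_const M p_infty) Hf).
Qed.

Lemma derives_on_incr_le_lim (a l : R) (F f : R -> R) (s : R) :
  derives_on a F f -> (forall r, a <= r -> 0 <= f r) ->
  is_lim F p_infty l -> a <= s -> F s <= l.
Proof.
intros HF Hf Hl Hs; apply (is_lim_ge_bound F l (F s) Hl).
apply filter_imp with (2 := eventually_ge s); intros t Ht.
apply (derives_on_incr a F f); auto; lra.
Qed.

Lemma derives_on_strict_incr_lt_lim (a l : R) (F f : R -> R) (s : R) :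
  derives_on a F f -> (forall r, a <= r -> 0 < f r) ->
  is_lim F p_infty l -> a <= s -> F s < l.
Proof.
intros HF Hf Hl Hs; apply Rlt_le_trans with (F (s + 1)).
- apply (derives_on_strict_incr a F f); auto; lra.
- apply (derives_on_incr_le_lim a l F f); auto; [|lra].
  intros; apply Rlt_le; auto.
Qed.

(** * Improper integrals and primitives *)

Lemma is_RInt_gen_primitive (a l : R) (F f : R -> R) (s : R) :
  continuous_on (fun t => a <= t) f -> derives_on a F f -> a <= s ->
  is_lim F p_infty l ->
  is_RInt_gen f (at_point s) (Rbar_locally p_infty) (l - F s).
Proof.
intros Hf HF Hs Hl P HP.
assert (H : is_lim (fun t => F t - F s) p_infty (l - F s)).
{ apply (is_lim_minus' F (fun _ => F s)); [exact Hl | apply is_lim_const]. }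
apply Filter_prod with (Q := fun r => r = s)
  (R := fun t => a <= t /\ P (F t - F s)).
- reflexivity.
- apply filter_and; [apply eventually_ge | exact (H P HP)].
- intros x t -> [Ht HPt]; exists (F t - F s); split; [|exact HPt].
  now apply (is_RInt_primitive a).
Qed.

Lemma is_RInt_gen_primitive_lim (a l : R) (F f : R -> R) (s : R) :
  continuous_on (fun t => a <= t) f -> derives_on a F f -> a <= s ->
  is_RInt_gen f (at_point s) (Rbar_locally p_infty) l ->
  is_lim F p_infty (l + F s).
Proof.
intros Hf HF Hs Hl; apply is_lim_spec; intros eps.
destruct (Hl (ball l eps) (locally_ball l eps)) as [Q R HQ HR H].
change (Rbar_locally p_infty (fun t => Rabs (F t - (l + F s)) < eps)).
generalize (filter_and _ _ HR (eventually_ge a)); apply filter_imp.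
intros t [Ht Hat]; destruct (H s t HQ Ht) as [y [Hy Hb]]; simpl in Hy.
rewrite <- (is_RInt_unique _ _ _ _ Hy) in Hb.
rewrite (is_RInt_unique _ _ _ _ (is_RInt_primitive a F f s t Hf HF Hs Hat)) in Hb.
replace (F t - (l + F s)) with (F t - F s - l) by ring.
exact Hb.
Qed.

(** The bridge from improper integrals to limits of primitives; all integral
    conditions below are handled through it. *)
Lemma integrable_at_infty_iff (a : R) (F f : R -> R) (s : R) :
  continuous_on (fun t => a <= t) f -> derives_on a F f -> a <= s ->
  integrable_at_infty f s <-> exists l : R, is_lim F p_infty l.
Proof.
intros Hf HF Hs; split; intros [l Hl].
- exists (l + F s); now apply (is_RInt_gen_primitive_lim a l F f).
- exists (l - F s); now apply (is_RInt_gen_primitive a).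
Qed.

Lemma int_to_infty_eq (a l : R) (F f : R -> R) (s : R) :
  continuous_on (fun t => a <= t) f -> derives_on a F f -> a <= s ->
  is_lim F p_infty l -> int_to_infty f s = l - F s.
Proof.
intros Hf HF Hs Hl.
apply (is_RInt_gen_unique (V := R_CompleteNormedModule) f).
now apply (is_RInt_gen_primitive a).
Qed.

(** * L'Hopital's rule at infinity *)

(** Beyond a point where [r] is within [eps / 2] of [l], the increments of [f]
    lie between [l - eps / 2] and [l + eps / 2] times those of [g]; what was
    gathered before that point is negligible because [g] is unbounded. *)
Lemma lhopital_infty (a l : R) (f g g' r : R -> R) :
  derives_on a f (fun t => g' t * r t) -> derives_on a g g' ->
  (forall t, a <= t -> 0 < g' t) ->
  is_lim g p_infty p_infty -> is_lim r p_infty l ->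
  is_lim (fun t => f t / g t) p_infty l.
Proof.
intros Hf Hg Hg' Hgl Hr.
assert (Hu : forall c, is_lim (fun t => c / g t) p_infty 0).
{ intros c; replace (Finite 0) with (Rbar_mult c (Rbar_inv p_infty))
    by (simpl; f_equal; ring).
  apply (is_lim_scal_l (fun t => / g t)), is_lim_inv; easy. }
apply is_lim_spec; intros eps.
change (Rbar_locally p_infty (fun t => Rabs (f t / g t - l) < eps)).
assert (He : 0 < eps / 2) by (generalize (cond_pos eps); lra).
set (e := mkposreal _ He).
apply is_lim_spec in Hr; destruct (Hr e) as [M HM].
set (b := Rmax a (M + 1)).
assert (Hab : a <= b) by apply Rmax_l.
assert (HMb : M < b) by (generalize (Rmax_r a (M + 1)); unfold b; lra).
(* [c] bounds everything in [f t - l * g t] that does not grow with [t]. *)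
set (c := Rabs (f b - l * g b) + eps * Rabs (g b)).
generalize (Hu c); intros Huc; apply is_lim_spec in Huc.
generalize (filter_and _ _ (Huc e) (eventually_ge b)).
intros H; generalize (filter_and _ _ H (proj2 (is_lim_spec _ _ _) Hgl 0)).
apply filter_imp; clear H; intros t [[Hct Hbt] Hgt].
assert (Hd : Rabs ((f t - l * g t) - (f b - l * g b)) <= eps / 2 * (g t - g b)).
{ apply Rabs_le; split.
  - cut ((l - eps / 2) * g t - (l - eps / 2) * g b <= f t - f b); [lra|].
    apply (derives_on_le b (fun t => (l - eps / 2) * g t)
      (fun t => (l - eps / 2) * g' t) f (fun t => g' t * r t)).
    + intros s Hs; apply (is_derive_scal g), Hg; lra.
    + now apply (derives_on_weaken a).
    + intros s Hs; rewrite Rmult_comm; apply Rmult_le_compat_l.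
      * apply Rlt_le, Hg'; lra.
      * assert (Hs' : M < s) by lra.
        generalize (HM s Hs'); intros Hrs; apply Rabs_def2 in Hrs; simpl in Hrs; lra.
    + lra.
  - cut (f t - f b <= (l + eps / 2) * g t - (l + eps / 2) * g b); [lra|].
    apply (derives_on_le b f (fun t => g' t * r t) (fun t => (l + eps / 2) * g t)
      (fun t => (l + eps / 2) * g' t)).
    + now apply (derives_on_weaken a).
    + intros s Hs; apply (is_derive_scal g), Hg; lra.
    + intros s Hs; rewrite (Rmult_comm (l + _)); apply Rmult_le_compat_l.
      * apply Rlt_le, Hg'; lra.
      * assert (Hs' : M < s) by lra.
        generalize (HM s Hs'); intros Hrs; apply Rabs_def2 in Hrs; simpl in Hrs; lra.
    + lra. }
replace (f t / g t - l) with ((f t - l * g t) / g t) by (field; lra).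
unfold Rdiv at 1; rewrite Rabs_mult, (Rabs_right (/ g t))
  by (apply Rle_ge, Rlt_le, Rinv_0_lt_compat, Hgt).
apply (Rmult_lt_reg_r (g t)); [exact Hgt|].
rewrite Rmult_assoc, Rinv_l, Rmult_1_r by lra.
assert (Hc : c < eps / 2 * g t).
{ apply Rabs_def2 in Hct; simpl in Hct.
  apply (Rmult_lt_reg_r (/ g t)); [now apply Rinv_0_lt_compat|].
  rewrite (Rmult_assoc (eps / 2)), Rinv_r by lra. unfold Rdiv in Hct; lra. }
assert (Ht : Rabs (f t - l * g t) <= Rabs (f b - l * g b) + eps / 2 * (g t - g b)).
{ generalize (Rabs_triang ((f t - l * g t) - (f b - l * g b)) (f b - l * g b)).
  replace (f t - l * g t - (f b - l * g b) + (f b - l * g b))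
    with (f t - l * g t) by ring. lra. }
assert (eps / 2 * - g b <= eps * Rabs (g b)).
{ apply Rle_trans with (eps / 2 * Rabs (g b)).
  - apply Rmult_le_compat_l; [lra|]; generalize (Rle_abs (- g b)); rewrite Rabs_Ropp; lra.
  - apply Rmult_le_compat_r; [apply Rabs_pos | lra]. }
unfold c in Hc; lra.
Qed.

(** Near infinity [f - (l - eps / 2) g] increases and [f - (l + eps / 2) g]
    decreases; both tend to [0], so their signs are known. *)
Lemma lhopital_zero (a l : R) (f g g' r : R -> R) :
  derives_on a f (fun t => g' t * r t) -> derives_on a g g' ->
  (forall t, a <= t -> 0 < g' t) ->
  is_lim f p_infty 0 -> is_lim g p_infty 0 -> is_lim r p_infty l ->
  is_lim (fun t => f t / g t) p_infty l.
Proof.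
intros Hf Hg Hg' Hfl Hgl Hr.
apply is_lim_spec; intros eps.
assert (He : 0 < eps / 2) by (generalize (cond_pos eps); lra).
set (e := mkposreal _ He).
apply is_lim_spec in Hr; destruct (Hr e) as [M HM].
exists (Rmax a M); intros t Ht.
assert (Hat : a < t) by (generalize (Rmax_l a M); lra).
assert (HMt : M < t) by (generalize (Rmax_r a M); lra).
assert (Hgt : g t < 0).
{ apply (derives_on_strict_incr_lt_lim a 0 g g'); auto; lra. }
assert (Hk : forall k, is_lim (fun s => f s - k * g s) p_infty 0).
{ intros k; replace 0 with (0 - k * 0) by ring.
  apply (is_lim_minus' f); [exact Hfl|].
  apply (is_lim_scal_l g k p_infty 0 Hgl). }
assert (H1 : f t - (l - eps / 2) * g t <= 0).
{ apply (derives_on_incr_le_lim t 0 (fun s => f s - (l - eps / 2) * g s)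
    (fun s => g' s * r s - (l - eps / 2) * g' s)); auto; [| |lra].
  - intros s Hs; apply (is_derive_minus f (fun s => (l - eps / 2) * g s)).
    + apply Hf; lra.
    + apply (is_derive_scal g), Hg; lra.
  - intros s Hs.
    replace (g' s * r s - (l - eps / 2) * g' s)
      with (g' s * (r s - (l - eps / 2))) by ring.
    apply Rmult_le_pos; [apply Rlt_le, Hg'; lra|].
    assert (Hs' : M < s) by lra.
    generalize (HM s Hs'); intros Hrs; apply Rabs_def2 in Hrs; simpl in Hrs; lra. }
assert (H2 : 0 <= f t - (l + eps / 2) * g t).
{ cut ((l + eps / 2) * g t - f t <= 0); [lra|].
  apply (derives_on_incr_le_lim t 0 (fun s => (l + eps / 2) * g s - f s)
    (fun s => (l + eps / 2) * g' s - g' s * r s)); auto; [| | |lra].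
  - intros s Hs; apply (is_derive_minus (fun s => (l + eps / 2) * g s) f).
    + apply (is_derive_scal g), Hg; lra.
    + apply Hf; lra.
  - intros s Hs.
    replace ((l + eps / 2) * g' s - g' s * r s)
      with (g' s * ((l + eps / 2) - r s)) by ring.
    apply Rmult_le_pos; [apply Rlt_le, Hg'; lra|].
    assert (Hs' : M < s) by lra.
    generalize (HM s Hs'); intros Hrs; apply Rabs_def2 in Hrs; simpl in Hrs; lra.
  - apply is_lim_ext with (fun s => - (f s - (l + eps / 2) * g s)); [intros; ring|].
    replace (Finite 0) with (Rbar_opp 0) by (simpl; f_equal; ring).
    apply is_lim_opp, Hk. }
apply Rle_lt_trans with (eps / 2); [|lra].
replace (f t / g t - l) with ((l * g t - f t) / - g t) by (field; lra).
unfold Rdiv at 1; rewrite Rabs_mult, (Rabs_right (/ - g t))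
  by (apply Rle_ge, Rlt_le, Rinv_0_lt_compat; lra).
apply (Rmult_le_reg_r (- g t)); [lra|].
rewrite Rmult_assoc, Rinv_l, Rmult_1_r by lra.
apply Rabs_le; lra.
Qed.

(** * Successive approximations *)

(** Approximations to the system [y_i' = k_i y_j], [{i, j} = {true, false}], with
    [y_i b = 1].  The index [i] stands for the component, so that one estimate
    serves for both. *)
Fixpoint picard (k : bool -> R -> R) (b : R) (n : nat) (i : bool) (t : R) : R :=
  match n with
  | O => 0
  | S m => 1 + RInt (fun s => k i s * picard k b m (negb i) s) b t
  end.

Lemma is_derive_RInt_continuous (f : R -> R) (b t : R) :
  (forall s, continuous f s) -> is_derive (RInt f b) t (f t).
Proof.
intros Hf; apply (is_derive_RInt f _ b); [|apply Hf].
exists (mkposreal 1 Rlt_0_1); intros s _.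
apply (RInt_correct (V := R_CompleteNormedModule)).
apply (ex_RInt_continuous (V := R_CompleteNormedModule)); intros; apply Hf.
Qed.

Lemma picard_continuous (k : bool -> R -> R) (b : R) (n : nat) (i : bool) :
  (forall j s, continuous (k j) s) -> forall t, continuous (picard k b n i) t.
Proof.
intros Hk; revert i; induction n as [|n IH]; intros i t.
- apply continuous_const.
- apply (continuous_plus (fun _ => 1)); [apply continuous_const|].
  apply (ex_derive_continuous (RInt (fun s => k i s * picard k b n (negb i) s) b)).
  exists (k i t * picard k b n (negb i) t).
  apply (is_derive_RInt_continuous (fun s => k i s * picard k b n (negb i) s)).
  intros s; apply (continuous_mult (k i)); auto.
Qed.

Lemma picard_derive (k : bool -> R -> R) (b : R) (n : nat) (i : bool) (t : R) :
  (forall j s, continuous (k j) s) ->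
  is_derive (picard k b (S n) i) t (k i t * picard k b n (negb i) t).
Proof.
intros Hk.
replace (k i t * picard k b n (negb i) t)
  with (plus 0 (k i t * picard k b n (negb i) t)) by apply Rplus_0_l.
apply (is_derive_plus (fun _ => 1)); [apply (is_derive_const 1)|].
apply (is_derive_RInt_continuous (fun s => k i s * picard k b n (negb i) s)).
intros s; apply (continuous_mult (k i)); [apply Hk | now apply picard_continuous].
Qed.

Lemma picard_start (k : bool -> R -> R) (b : R) (n : nat) (i : bool) :
  picard k b (S n) i b = 1.
Proof.
simpl; rewrite (RInt_point b (fun s => k i s * picard k b n (negb i) s)).
apply Rplus_0_r.
Qed.

Lemma picard_1 (k : bool -> R -> R) (b : R) (i : bool) (t : R) :
  picard k b 1 i t = 1.
Proof.
simpl; rewrite (RInt_ext _ (fun _ => 0)) by (intros; apply Rmult_0_r).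
rewrite RInt_const; unfold scal; simpl; unfold mult; simpl; ring.
Qed.

(** The weight [w] satisfies [w' = 2 (k_true + k_false) w]; the factor [2] is
    what makes the increments decay like [w / 2 ^ n]. *)
Definition picard_weight (k : bool -> R -> R) (b t : R) : R :=
  exp (2 * RInt (fun s => k true s + k false s) b t).

Lemma picard_weight_derive (k : bool -> R -> R) (b t : R) :
  (forall j s, continuous (k j) s) ->
  is_derive (picard_weight k b) t
    (2 * (k true t + k false t) * picard_weight k b t).
Proof.
intros Hk.
apply (is_derive_comp exp (fun t => 2 * RInt (fun s => k true s + k false s) b t)).
- apply is_derive_exp.
- apply (is_derive_scal (RInt (fun s => k true s + k false s) b)).
  apply (is_derive_RInt_continuous (fun s => k true s + k false s)).
  intros s; apply (continuous_plus (k true)); apply Hk.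
Qed.

Lemma picard_weight_incr (k : bool -> R -> R) (b s t : R) :
  (forall j s, continuous (k j) s) -> (forall j s, 0 < k j s) ->
  b <= s <= t -> picard_weight k b s <= picard_weight k b t.
Proof.
intros Hk Hp; apply derives_on_incr with
  (f := fun t => 2 * (k true t + k false t) * picard_weight k b t).
- intros r _; now apply picard_weight_derive.
- intros r _; generalize (Hp true r) (Hp false r); intros.
  apply Rmult_le_pos; [lra | apply Rlt_le, exp_pos].
Qed.

Lemma picard_weight_start (k : bool -> R -> R) (b : R) : picard_weight k b b = 1.
Proof.
unfold picard_weight; rewrite (RInt_point b (fun s => k true s + k false s)).
change (zero : R) with 0; rewrite Rmult_0_r; apply exp_0.
Qed.

(** Each increment but the first is a primitive of [k i] times the previous
    increment of the other component, hence nonnegative and dominated through derivatives: if the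
    previous one is at most [w / 2 ^ n], then its product with [k i] is at most
    the derivative of [w / 2 ^ (n + 1)]. *)
Lemma picard_step (k : bool -> R -> R) (b : R) (n : nat) (i : bool) (t : R) :
  (forall j s, continuous (k j) s) -> (forall j s, 0 < k j s) -> b <= t ->
  0 <= picard k b (S n) i t - picard k b n i t <= picard_weight k b t * (1/2) ^ n.
Proof.
intros Hk Hp; revert i t; induction n as [|n IH]; intros i t Ht.
- rewrite picard_1; simpl picard; simpl pow.
  generalize (picard_weight_incr k b b t Hk Hp); rewrite picard_weight_start; lra.
- assert (Hd : derives_on b (fun t => picard k b (S (S n)) i t - picard k b (S n) i t)
    (fun t => k i t * (picard k b (S n) (negb i) t - picard k b n (negb i) t))).
  { intros s _; rewrite Rmult_minus_distr_l.
    apply (is_derive_minus (picard k b (S (S n)) i) (picard k b (S n) i));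
      now apply picard_derive. }
  assert (H0 : picard k b (S (S n)) i b - picard k b (S n) i b = 0)
    by (rewrite 2!picard_start; ring).
  assert (Hw : derives_on b (fun t => picard_weight k b t * (1/2) ^ S n)
    (fun t => (k true t + k false t) * (picard_weight k b t * (1/2) ^ n))).
  { intros s _; apply is_derive_ext
      with (fun t => (1/2) ^ S n * picard_weight k b t); [intros; apply Rmult_comm|].
    replace ((k true s + k false s) * (picard_weight k b s * (1/2) ^ n))
      with ((1/2) ^ S n * (2 * (k true s + k false s) * picard_weight k b s))
      by (simpl; field).
    now apply (is_derive_scal (picard_weight k b)), picard_weight_derive. }
  split.
  + rewrite <- H0; refine (derives_on_incr b _ _ b t Hd _ _); [|lra].
    intros r Hr; apply Rmult_le_pos; [apply Rlt_le, Hp | now apply IH].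
  + assert (Hle : (picard k b (S (S n)) i t - picard k b (S n) i t) -
        (picard k b (S (S n)) i b - picard k b (S n) i b)
      <= picard_weight k b t * (1/2) ^ S n - picard_weight k b b * (1/2) ^ S n).
    { refine (derives_on_le b _ _ _ _ b t Hd Hw _ _); [|lra].
      intros r Hr; apply Rmult_le_compat.
      - apply Rlt_le, Hp.
      - now apply IH.
      - generalize (Hp true r) (Hp false r); destruct i; lra.
      - now apply IH. }
    rewrite H0, picard_weight_start in Hle.
    generalize (pow_lt (1/2) (S n)); lra.
Qed.

Lemma picard_tail (k : bool -> R -> R) (b : R) (n m : nat) (i : bool) (t : R) :
  (forall j s, continuous (k j) s) -> (forall j s, 0 < k j s) -> b <= t ->
  (n <= m)%nat ->
  0 <= picard k b m i t - picard k b n i t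
    <= 2 * picard_weight k b t * (1/2) ^ n.
Proof.
intros Hk Hp Ht Hnm.
assert (H : 0 <= picard k b m i t - picard k b n i t
  <= picard_weight k b t * (2 * (1/2) ^ n - 2 * (1/2) ^ m)).
{ induction Hnm as [|m Hnm IH]; [lra|].
  generalize (picard_step k b m i t Hk Hp Ht); simpl pow; lra. }
assert (0 <= picard_weight k b t * (2 * (1/2) ^ m)).
{ apply Rmult_le_pos; [apply Rlt_le, exp_pos|].
  generalize (pow_lt (1/2) m); lra. }
lra.
Qed.

(** The factor [h] is there so that the statement applies to the approximations
    ([h = 1]) and to their derivatives ([h = k i]). *)
Lemma picard_cauchy (k : bool -> R -> R) (b c : R) (i : bool) (h : R -> R) :
  (forall j s, continuous (k j) s) -> (forall j s, 0 < k j s) -> b < c ->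
  (forall s, continuous h s) ->
  CVU_cauchy (fun n t => h t * picard k b n i t) (fun t => b < t < c).
Proof.
intros Hk Hp Hbc Hh eps.
destruct (continuity_ab_maj (fun s => Rabs (h s)) b c) as [c0 [Hc0 _]]; [lra| |].
{ intros s _; apply continuity_pt_filterlim.
  apply (continuous_comp h Rabs); [apply Hh | apply continuous_Rabs]. }
(* Any two approximations after the [N]-th differ from it by at most
   [2 w / 2 ^ N], both from above; the [+ 1] keeps [K] positive if [h = 0]. *)
set (K := (Rabs (h c0) + 1) * (2 * picard_weight k b c)).
assert (HK : 0 < K).
{ apply Rmult_lt_0_compat; [generalize (Rabs_pos (h c0)); lra|].
  generalize (exp_pos (2 * RInt (fun s => k true s + k false s) b c)).
  unfold picard_weight; lra. }
destruct (pow_lt_1_zero (1/2)) with (y := eps / K) as [N HN].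
{ rewrite Rabs_right; lra. }
{ apply Rdiv_lt_0_compat; [apply cond_pos | exact HK]. }
specialize (HN N (le_n N)).
assert (Hw : 0 < (1/2) ^ N) by (apply pow_lt; lra).
rewrite Rabs_right in HN by lra.
exists N; intros n m t Ht Hn Hm.
apply Rle_lt_trans with (K * (1/2) ^ N).
- rewrite <- Rmult_minus_distr_l, Rabs_mult; unfold K; rewrite Rmult_assoc.
  apply Rmult_le_compat; try apply Rabs_pos.
  + generalize (Hc0 t); lra.
  + assert (Hbt : b <= t) by lra.
    generalize (picard_tail k b N n i t Hk Hp Hbt Hn).
    generalize (picard_tail k b N m i t Hk Hp Hbt Hm).
    assert (2 * picard_weight k b t * (1/2) ^ N
            <= 2 * picard_weight k b c * (1/2) ^ N).
    { apply Rmult_le_compat_r; [lra|].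
      apply Rmult_le_compat_l; [lra|].
      apply picard_weight_incr; auto; lra. }
    intros; apply Rabs_le; lra.
- apply (Rmult_lt_reg_r (/ K)); [now apply Rinv_0_lt_compat|].
  replace (K * (1/2) ^ N * / K) with ((1/2) ^ N) by (field; lra); exact HN.
Qed.

Definition picard_limit (k : bool -> R -> R) (b : R) (i : bool) (t : R) : R :=
  Lim_seq (fun n => picard k b n i t).

Lemma picard_limit_correct (k : bool -> R -> R) (b : R) (i : bool) (t : R) :
  (forall j s, continuous (k j) s) -> (forall j s, 0 < k j s) -> b <= t ->
  is_lim_seq (fun n => picard k b n i t) (picard_limit k b i t).
Proof.
intros Hk Hp Ht; apply Lim_seq_correct'.
apply ex_finite_lim_seq_incr with (2 * picard_weight k b t); intros n.
- generalize (picard_step k b n i t Hk Hp Ht); lra.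
- assert (H0n : (0 <= n)%nat) by lia.
  generalize (picard_tail k b 0 n i t Hk Hp Ht H0n); simpl; lra.
Qed.

Lemma picard_limit_derive (k : bool -> R -> R) (b : R) (i : bool) (t : R) :
  (forall j s, continuous (k j) s) -> (forall j s, 0 < k j s) -> b < t ->
  is_derive (picard_limit k b i) t (k i t * picard_limit k b (negb i) t).
Proof.
intros Hk Hp Ht.
assert (Hd : forall n s,
  Derive (picard k b (S n) i) s = k i s * picard k b n (negb i) s).
{ intros n s; apply is_derive_unique; now apply picard_derive. }
replace (k i t * picard_limit k b (negb i) t)
  with (real (Lim_seq (fun n => Derive (picard k b (S n) i) t))).
2:{ rewrite (Lim_seq_ext _ (fun n => k i t * picard k b n (negb i) t))
      by (intros; apply Hd).
    apply f_equal with (f := real) (y := Finite _), is_lim_seq_unique.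
    apply (is_lim_seq_scal_l _ (k i t) (picard_limit k b (negb i) t)).
    apply picard_limit_correct; auto; lra. }
apply is_derive_ext with
  (fun s => real (Lim_seq (fun n => picard k b (S n) i s))).
{ intros s; unfold picard_limit; f_equal.
  apply (Lim_seq_incr_1 (fun n => picard k b n i s)). }
apply (CVU_Derive (fun n => picard k b (S n) i) (fun s => b < s < t + 1)).
- apply open_and; [apply open_gt | apply open_lt].
- intros x y z Hx Hy; lra.
- apply CVU_dom_cauchy; intros eps.
  assert (Hbt : b < t + 1) by lra.
  destruct (picard_cauchy k b (t + 1) i (fun _ => 1) Hk Hp Hbt
    (fun s => continuous_const 1 s) eps) as [N HN].
  exists N; intros n m s Hs Hn Hm.
  rewrite <- (Rmult_1_l (picard k b (S n) i s)), <- (Rmult_1_l (picard k b (S m) i s)).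
  apply HN; auto.
- intros n s _; eexists; now apply picard_derive.
- intros n s _; apply continuity_pt_filterlim.
  apply (continuous_ext (fun r => k i r * picard k b n (negb i) r)).
  { intros r; symmetry; apply Hd. }
  apply (continuous_mult (k i)); [apply Hk | now apply picard_continuous].
- apply CVU_dom_cauchy; intros eps.
  assert (Hbt : b < t + 1) by lra.
  destruct (picard_cauchy k b (t + 1) (negb i) (k i) Hk Hp Hbt (Hk i) eps) as [N HN].
  exists N; intros n m s Hs Hn Hm; rewrite 2!Hd; now apply HN.
- lra.
Qed.

(** The approximations increase with [n], and the first one is [1]. *)
Lemma picard_limit_ge_1 (k : bool -> R -> R) (b : R) (i : bool) (t : R) :
  (forall j s, continuous (k j) s) -> (forall j s, 0 < k j s) -> b <= t ->
  1 <= picard_limit k b i t.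
Proof.
intros Hk Hp Ht.
assert (H : Rbar_le 1 (picard_limit k b i t)); [|exact H].
apply is_lim_seq_le with (fun _ => 1) (fun n => picard k b (S n) i t).
- intros n; assert (Hn : (1 <= S n)%nat) by lia.
  generalize (picard_tail k b 1 (S n) i t Hk Hp Ht Hn); rewrite picard_1; lra.
- apply is_lim_seq_const.
- apply (is_lim_seq_incr_1 (fun n => picard k b n i t)).
  now apply picard_limit_correct.
Qed.

(** * The first-order system *)

(** The equation as a first-order system with two-sided derivatives, [z] being
    the quasi-derivative of [x]. *)
Definition flow (p q : R -> R) (a : R) (x z : R -> R) : Prop :=
  derives_on a x (fun t => z t / p t) /\ derives_on a z (fun t => q t * x t).

Lemma flow_weaken (p q : R -> R) (a T : R) (x z : R -> R) :
  a <= T -> flow p q a x z -> flow p q T x z.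
Proof. intros HaT [Hx Hz]; split; now apply (derives_on_weaken a). Qed.

Lemma flow_scal (p q : R -> R) (a c : R) (x z : R -> R) :
  flow p q a x z -> flow p q a (fun t => c * x t) (fun t => c * z t).
Proof.
intros [Hx Hz]; split; intros t Ht.
- replace (c * z t / p t) with (c * (z t / p t)) by (unfold Rdiv; ring).
  now apply (is_derive_scal x), Hx.
- replace (q t * (c * x t)) with (c * (q t * x t)) by ring.
  now apply (is_derive_scal z), Hz.
Qed.

(** Successive approximations start at [a - 1], with coefficients continued
    by constants to the left of [a], so that the limit has two-sided
    derivatives at [a] as well. *)
Lemma exists_growing_flow (a : R) (p q : R -> R) :
  continuous_on (fun t => a <= t) p -> continuous_on (fun t => a <= t) q ->
  (forall t, a <= t -> 0 < p t) -> (forall t, a <= t -> 0 < q t) ->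
  exists x z, flow p q a x z /\ forall t, a <= t -> 1 <= x t /\ 1 <= z t.
Proof.
intros p_cont q_cont p_pos q_pos.
set (k := fun (i : bool) t => if i then / p (Rmax a t) else q (Rmax a t)).
assert (Hk : forall j s, continuous (k j) s).
{ intros j s; destruct j; cbv beta iota delta [k].
  - apply (continuous_on_Rmax a (fun t => / p t)), continuous_on_inv; [exact p_cont|].
    intros t Ht; generalize (p_pos t Ht); lra.
  - now apply (continuous_on_Rmax a q). }
assert (Hp : forall j s, 0 < k j s).
{ intros [|] s; simpl.
  - apply Rinv_0_lt_compat, p_pos, Rmax_l.
  - apply q_pos, Rmax_l. }
exists (picard_limit k (a - 1) true), (picard_limit k (a - 1) false).
split; [split|]; intros t Ht.
- replace (picard_limit k (a - 1) false t / p t)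
    with (k true t * picard_limit k (a - 1) (negb true) t).
  + apply picard_limit_derive; auto; lra.
  + simpl; rewrite Rmax_right by easy; apply Rmult_comm.
- replace (q t) with (k false t) by (simpl; now rewrite Rmax_right).
  apply (picard_limit_derive k (a - 1) false); auto; lra.
- split; apply picard_limit_ge_1; auto; lra.
Qed.

Lemma is_derive_from_of_is_derive (T : R) (f : R -> R) (t l : R) :
  T <= t -> is_derive f t l -> is_derive_from T f t l.
Proof.
intros Ht Hf.
assert (Hproper : ProperFilter (within (fun s => T <= s) (locally t))).
{ constructor; [|apply within_filter, locally_filter].
  intros S [d Hd]; exists (t + d / 2); generalize (cond_pos d); intros Hdp.
  apply Hd; [|lra].
  apply Rabs_def1; unfold minus, plus, opp; simpl; lra. }
apply (filterdiff_locally f t).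
- intros S HS; now apply filter_le_within.
- exact Hf.
Qed.

(** Continuing [f] to the left of [T] by its tangent at [T] turns the one-sided
    derivative into a two-sided one. *)
Lemma is_derive_from_extend (T : R) (f l : R -> R) :
  (forall t, T <= t -> is_derive_from T f t (l t)) ->
  exists g, derives_on T g l /\ forall t, T <= t -> g t = f t.
Proof.
intros Hf.
exists (fun t => if Rle_dec T t then f t else f T + (t - T) * l T); split.
2:{ intros t Ht; destruct (Rle_dec T t); [easy | contradiction]. }
intros t Ht; split; [apply is_linear_scal_l|].
intros x Hx.
replace x with t in * by
  (apply (is_filter_lim_locally_unique (V := R_NormedModule) t x Hx)).
clear x Hx; intros eps.
destruct (Hf t Ht) as [_ Hdom].
assert (Hlim : is_filter_lim (within (fun s => T <= s) (locally t)) t)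
  by (intros S HS; now apply filter_le_within).
generalize (Hdom t Hlim eps); unfold within; intros Hloc.
destruct (Rle_dec T t) as [_|]; [|contradiction].
destruct Ht as [Ht | <-].
- generalize (filter_and _ _ Hloc (open_gt T t Ht)); apply filter_imp.
  intros s [Hs HTs]; destruct (Rle_dec T s) as [H|H]; [now apply Hs | lra].
- revert Hloc; apply filter_imp; intros s Hs.
  destruct (Rle_dec T s) as [H|H]; [now apply Hs|].
  apply Rle_trans with 0.
  + apply Req_le; transitivity (norm (zero : R_NormedModule)); [|apply norm_zero].
    f_equal; unfold minus, plus, opp, scal, zero; simpl; unfold mult; simpl; ring.
  + apply Rmult_le_pos; [apply Rlt_le, cond_pos | apply norm_ge_0].
Qed.

Lemma solves_of_flow (p q : R -> R) (T : R) (x z : R -> R) :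
  (forall t, T <= t -> p t <> 0) -> flow p q T x z -> solves p q T x z.
Proof.
intros Hp [Hx Hz]; split; intros t Ht.
- exists (z t / p t); split.
  + apply is_derive_from_of_is_derive; auto.
  + field; auto.
- apply is_derive_from_of_is_derive; auto.
Qed.

Lemma flow_of_solves (p q : R -> R) (T : R) (x Dx : R -> R) :
  (forall t, T <= t -> p t <> 0) -> solves p q T x Dx ->
  exists y w, flow p q T y w /\ forall t, T <= t -> y t = x t /\ w t = Dx t.
Proof.
intros Hp [Hx HDx].
destruct (is_derive_from_extend T x (fun t => Dx t / p t)) as [y [Hy Ey]].
{ intros t Ht; destruct (Hx t Ht) as [l [Hl ->]].
  replace (p t * l / p t) with l by (field; auto); exact Hl. }
destruct (is_derive_from_extend T Dx (fun t => q t * x t) HDx) as [w [Hw Ew]].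
exists y, w; split; [split|auto].
- apply derives_on_ext with (2 := Hy); intros t Ht; now rewrite Ew.
- apply derives_on_ext with (2 := Hw); intros t Ht; now rewrite Ey.
Qed.

(** * The solution space *)

Lemma wronskian_constant (p q : R -> R) (T : R) (x z y w : R -> R) :
  flow p q T x z -> flow p q T y w ->
  forall t, T <= t -> x t * w t - y t * z t = x T * w T - y T * z T.
Proof.
intros [Hx Hz] [Hy Hw] t Ht.
assert (H : derives_on T (fun t => x t * w t - y t * z t) (fun _ => 0)).
{ intros s Hs.
  replace 0 with ((z s / p s * w s + x s * (q s * y s)) -
                  (w s / p s * z s + y s * (q s * x s)))
    by (unfold Rdiv; ring).
  apply (is_derive_minus (fun t => x t * w t) (fun t => y t * z t)).
  - apply (is_derive_mult x w); auto; intros; apply Rmult_comm.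
  - apply (is_derive_mult y z); auto; intros; apply Rmult_comm. }
destruct (derives_on_mean T _ _ T t H) as [c [_ Hc]]; [lra|]; lra.
Qed.

(** The coefficients are Wronskians of the solution with the basis, hence
    constant, and Cramer's rule recovers the solution at every [t]. *)
Lemma solves_span (p q : R -> R) (a : R) (x1 z1 x2 z2 : R -> R) :
  (forall t, a <= t -> p t <> 0) ->
  flow p q a x1 z1 -> flow p q a x2 z2 ->
  (forall t, a <= t -> x1 t * z2 t - x2 t * z1 t = 1) ->
  forall T x Dx, a <= T -> solves p q T x Dx ->
  exists c1 c2 : R, forall t, T <= t ->
    x t = c1 * x1 t + c2 * x2 t /\ Dx t = c1 * z1 t + c2 * z2 t.
Proof.
intros Hp H1 H2 HW T x Dx HaT Hx.
destruct (flow_of_solves p q T x Dx) as [y [w [Hyw E]]]; auto.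
{ intros t Ht; apply Hp; lra. }
exists (y T * z2 T - x2 T * w T), (x1 T * w T - y T * z1 T).
intros t Ht; destruct (E t Ht) as [<- <-].
assert (Hat : a <= t) by lra.
rewrite <- (wronskian_constant p q T y w x2 z2 Hyw (flow_weaken _ _ _ _ _ _ HaT H2) t Ht).
rewrite <- (wronskian_constant p q T x1 z1 y w (flow_weaken _ _ _ _ _ _ HaT H1) Hyw t Ht).
split.
- transitivity (y t * (x1 t * z2 t - x2 t * z1 t)); [rewrite HW by easy|]; ring.
- transitivity (w t * (x1 t * z2 t - x2 t * z1 t)); [rewrite HW by easy|]; ring.
Qed.

(** The determinant of the values at [T] and [T + 1] is positive. *)
Lemma monotone_independent (T c1 c2 : R) (x1 x2 : R -> R) :
  0 < x1 (T + 1) <= x1 T -> 0 < x2 T < x2 (T + 1) ->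
  (forall t, T <= t -> c1 * x1 t + c2 * x2 t = 0) -> c1 = 0 /\ c2 = 0.
Proof.
intros H1 H2 H0.
assert (E : c1 * x1 T + c2 * x2 T = 0) by (apply H0; lra).
assert (E' : c1 * x1 (T + 1) + c2 * x2 (T + 1) = 0) by (apply H0; lra).
assert (Hdet : 0 < x1 T * x2 (T + 1) - x1 (T + 1) * x2 T).
{ assert (x1 (T + 1) * x2 T < x1 (T + 1) * x2 (T + 1))
    by (apply Rmult_lt_compat_l; lra).
  assert (x1 (T + 1) * x2 (T + 1) <= x1 T * x2 (T + 1))
    by (apply Rmult_le_compat_r; lra).
  lra. }
assert (Hc1 : c1 = 0).
{ apply (Rmult_eq_reg_r (x1 T * x2 (T + 1) - x1 (T + 1) * x2 T)); [|lra].
  replace (c1 * (x1 T * x2 (T + 1) - x1 (T + 1) * x2 T))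
    with ((c1 * x1 T + c2 * x2 T) * x2 (T + 1)
          - (c1 * x1 (T + 1) + c2 * x2 (T + 1)) * x2 T) by ring.
  rewrite E, E'; ring. }
split; [exact Hc1|].
apply (Rmult_eq_reg_r (x2 T)); [|lra]; rewrite Hc1 in E; lra.
Qed.

(** The limit of [Dx] is [c2], and [x] tends to [c1] when [c2 = 0], to infinity
    with the sign of [c2] otherwise. *)
Lemma moderate_of_combination (T c1 c2 : R) (x1 z1 x2 z2 x Dx : R -> R) :
  is_lim x1 p_infty 1 -> is_lim z1 p_infty 0 ->
  is_lim x2 p_infty p_infty -> is_lim z2 p_infty 1 ->
  (forall t, T <= t -> x t = c1 * x1 t + c2 * x2 t /\ Dx t = c1 * z1 t + c2 * z2 t) ->
  (exists t, T <= t /\ x t <> 0) -> moderate x Dx.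
Proof.
intros Hx1 Hz1 Hx2 Hz2 E [t0 [Ht0 Hnz]].
assert (HD : is_lim Dx p_infty c2).
{ apply (is_lim_ext_loc (fun t => c1 * z1 t + c2 * z2 t)).
  { generalize (eventually_ge T); apply filter_imp; intros t Ht.
    symmetry; now apply E. }
  replace (Finite c2) with (Finite (c1 * 0 + c2 * 1)) by (f_equal; ring).
  apply (is_lim_plus' (fun t => c1 * z1 t) (fun t => c2 * z2 t)).
  - apply (is_lim_scal_l z1 c1 p_infty 0 Hz1).
  - apply (is_lim_scal_l z2 c2 p_infty 1 Hz2). }
assert (H1 : is_lim (fun t => c1 * x1 t) p_infty c1).
{ replace (Finite c1) with (Finite (c1 * 1)) by (f_equal; ring).
  apply (is_lim_scal_l x1 c1 p_infty 1 Hx1). }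
assert (Hfin : forall c, c <> 0 -> finite_nonzero (Finite c)).
{ intros c Hc; split; simpl; [now apply Rabs_pos_lt | exact I]. }
destruct (Req_dec c2 0) as [Hc2 | Hc2].
- exists c1, c2; split; [split; [|exact HD]|].
  + apply is_lim_ext_loc with (2 := H1).
    generalize (eventually_ge T); apply filter_imp; intros t Ht.
    rewrite (proj1 (E t Ht)), Hc2; ring.
  + right; split; [|now rewrite Hc2].
    apply Hfin; intros Hc1; apply Hnz.
    rewrite (proj1 (E t0 Ht0)), Hc1, Hc2; ring.
- assert (H2 : is_lim (fun t => c2 * x2 t) p_infty (Rbar_mult c2 p_infty))
    by now apply is_lim_scal_l.
  exists (Rbar_mult c2 p_infty), c2; split; [split; [|exact HD]|].
  + apply (is_lim_ext_loc (fun t => c1 * x1 t + c2 * x2 t)).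
    { generalize (eventually_ge T); apply filter_imp; intros t Ht.
      symmetry; now apply E. }
    apply is_lim_plus with (1 := H1) (2 := H2).
    unfold is_Rbar_plus; simpl; destruct (Rle_dec 0 c2) as [Hle|Hle];
      [destruct (Rle_lt_or_eq_dec 0 c2 Hle) as [Hlt|Heq]|]; try reflexivity.
    now destruct Hc2.
  + left; split; [|now apply Hfin].
    simpl; destruct (Rle_dec 0 c2) as [Hle|Hle];
      [destruct (Rle_lt_or_eq_dec 0 c2 Hle) as [Hlt|Heq]|]; try reflexivity.
    now destruct Hc2.
Qed.

(** * Reproduction from the Riccati equations *)

(** Replacing one normalisation of the primitive by another multiplies the
    exponential by a nonzero constant, so the convergent and the divergent case
    are treated alike. *)
Lemma represented_of_primitive (x g f F : R -> R) (S c : R) :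
  continuous_on (fun t => S <= t) f -> derives_on S F f -> c <> 0 ->
  (forall t, S <= t -> x t = c * (g t * exp (F t))) -> represented x g f S.
Proof.
intros Hf HF Hc Hx.
destruct (classic (integrable_at_infty f S)) as [Hi | Hn].
- destruct (proj1 (integrable_at_infty_iff S F f S Hf HF (Rle_refl S)) Hi) as [l Hl].
  exists (c * exp l); split.
  + apply Rmult_integral_contrapositive_currified; [exact Hc|].
    generalize (exp_pos l); lra.
  + right; split; [exact Hi|].
    generalize (eventually_ge S); apply filter_imp; intros t Ht.
    rewrite (int_to_infty_eq S l F f t Hf HF Ht Hl), (Hx t Ht).
    replace (F t) with (l + - (l - F t)) at 1 by ring.
    rewrite exp_plus; ring.
- exists (c * exp (F S)); split.
  + apply Rmult_integral_contrapositive_currified; [exact Hc|].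
    generalize (exp_pos (F S)); lra.
  + left; split; [exact Hn|].
    generalize (eventually_ge S); apply filter_imp; intros t Ht.
    rewrite (is_RInt_unique _ _ _ _
      (is_RInt_primitive S F f S t Hf HF (Rle_refl S) Ht)), (Hx t Ht).
    replace (F t) with (F S + (F t - F S)) at 1 by ring.
    rewrite exp_plus; ring.
Qed.

Lemma derives_on_ln (p q : R -> R) (a : R) (x z : R -> R) :
  flow p q a x z -> (forall t, a <= t -> 0 < x t) ->
  derives_on a (fun t => ln (x t)) (fun t => z t / p t * / x t).
Proof.
intros [Hx _] Hpos t Ht.
apply (is_derive_comp ln x); [apply is_derive_ln|]; auto.
Qed.

Lemma flow_continuous (p q : R -> R) (a : R) (x z : R -> R) :
  flow p q a x z ->
  continuous_on (fun t => a <= t) x /\ continuous_on (fun t => a <= t) z.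
Proof. intros [Hx Hz]; split; eapply derives_on_continuous; eassumption. Qed.

Lemma log_derivative_continuous (p q : R -> R) (a : R) (x z : R -> R) :
  continuous_on (fun t => a <= t) p -> (forall t, a <= t -> p t <> 0) ->
  flow p q a x z -> (forall t, a <= t -> 0 < x t) ->
  continuous_on (fun t => a <= t) (fun t => z t / p t * / x t).
Proof.
intros Hpc Hp Hxz Hpos; destruct (flow_continuous p q a x z Hxz) as [Hx Hz].
apply continuous_on_mult; [apply continuous_on_mult; [exact Hz|]|].
- now apply continuous_on_inv.
- apply continuous_on_inv; [exact Hx|]; intros t Ht; generalize (Hpos t Ht); lra.
Qed.

Lemma reproduced_from_R1_of_flow (p q : R -> R) (a : R) (x z : R -> R) :
  continuous_on (fun t => a <= t) p -> (forall t, a <= t -> p t <> 0) ->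
  flow p q a x z -> (forall t, a <= t -> 0 < x t) ->
  reproduced_from_R1 p q a x.
Proof.
intros Hpc Hp Hxz Hpos.
assert (Hx0 : forall t, a <= t -> x t <> 0)
  by (intros t Ht; generalize (Hpos t Ht); lra).
exists a, (fun t => z t / x t); split; [apply Rle_refl|]; split.
- intros t Ht; apply is_derive_from_of_is_derive; [exact Ht|].
  replace (q t - (z t / x t) ^ 2 / p t)
    with ((q t * x t * x t - z t / p t * z t) / x t ^ 2) by (field; auto).
  destruct Hxz as [Hx Hz].
  replace (z t / p t * z t) with (z t * (z t / p t)) by ring.
  replace (q t * x t * x t) with ((q t * x t) * x t) by ring.
  apply (is_derive_div z x); auto.
- assert (E : forall t, a <= t -> z t / p t * / x t = z t / x t / p t)
    by (intros t Ht; field; auto).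
  left; apply (represented_of_primitive _ _ _ (fun t => ln (x t)) a 1).
  + apply continuous_on_ext with (1 := E).
    now apply (log_derivative_continuous p q).
  + now apply derives_on_ext with (1 := E), (derives_on_ln p q).
  + lra.
  + intros t Ht; rewrite exp_ln by auto; ring.
Qed.

Lemma reproduced_from_R2_of_flow (p q : R -> R) (a : R) (x z : R -> R) :
  continuous_on (fun t => a <= t) p -> (forall t, a <= t -> p t <> 0) ->
  flow p q a x z -> (forall t, a <= t -> 0 < x t) ->
  (forall t, a <= t -> z t <> 0) ->
  reproduced_from_R2 p q a x.
Proof.
intros Hpc Hp Hxz Hpos Hz0.
assert (Hx0 : forall t, a <= t -> x t <> 0)
  by (intros t Ht; generalize (Hpos t Ht); lra).
exists a, (fun t => x t / z t); split; [apply Rle_refl|]; split; [|split].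
- intros t Ht; apply is_derive_from_of_is_derive; [exact Ht|].
  replace (/ p t - q t * (x t / z t) ^ 2)
    with (((z t / p t) * z t - x t * (q t * x t)) / z t ^ 2) by (field; auto).
  destruct Hxz as [Hx Hz]; apply (is_derive_div x z); auto.
- intros t Ht; apply Rmult_integral_contrapositive_currified; auto.
  apply Rinv_neq_0_compat; auto.
- assert (E : forall t, a <= t -> z t / p t * / x t = / (p t * (x t / z t)))
    by (intros t Ht; field; auto).
  left; apply (represented_of_primitive _ _ _ (fun t => ln (x t)) a 1).
  + apply continuous_on_ext with (1 := E).
    now apply (log_derivative_continuous p q).
  + now apply derives_on_ext with (1 := E), (derives_on_ln p q).
  + lra.
  + intros t Ht; rewrite exp_ln by auto; ring.
Qed.

(** * Asymptotics under the integral condition *)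

Section Equation.

Context (a : R) (p q : R -> R).
Context (p_cont : continuous_on (fun t => a <= t) p).
Context (q_cont : continuous_on (fun t => a <= t) q).
Context (p_pos : forall t, a <= t -> 0 < p t).
Context (q_pos : forall t, a <= t -> 0 < q t).

Context (P Q G : R -> R).
Context (P_start : P a = 0).
Context (P_derive : derives_on a P (fun t => / p t)).
Context (P_lim : is_lim P p_infty p_infty).
Context (Q_derive : derives_on a Q q).
Context (G_derive : derives_on a G (fun t => q t * P t)).

Lemma p_neq_0 : forall t, a <= t -> p t <> 0.
Proof. intros t Ht; generalize (p_pos t Ht); lra. Qed.

Lemma q_nonneg : forall t, a <= t -> 0 <= q t.
Proof. intros t Ht; now apply Rlt_le, q_pos. Qed.

Lemma P_nonneg : forall t, a <= t -> 0 <= P t.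
Proof.
intros t Ht; rewrite <- P_start; apply (derives_on_incr a P (fun t => / p t)); auto.
- intros r Hr; now apply Rlt_le, Rinv_0_lt_compat, p_pos.
- lra.
Qed.

Lemma qP_nonneg : forall t, a <= t -> 0 <= q t * P t.
Proof. intros t Ht; apply Rmult_le_pos; [now apply q_nonneg | now apply P_nonneg]. Qed.

Lemma P_eventually (M : R) : Rbar_locally p_infty (fun t => M < P t).
Proof. exact (proj2 (is_lim_spec _ _ _) P_lim M). Qed.

Lemma flow_growing (x z : R -> R) :
  flow p q a x z -> (forall t, a <= t -> 0 <= x t) ->
  forall t, a <= t -> z a <= z t.
Proof.
intros [_ Hz] Hx t Ht; apply (derives_on_incr a z (fun t => q t * x t)); auto; [|lra].
intros r Hr; apply Rmult_le_pos; [now apply q_nonneg | auto].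
Qed.

(** Here [x' = z / p >= 1 / p]. *)
Lemma P_le_growing (x z : R -> R) :
  flow p q a x z -> (forall t, a <= t -> 1 <= x t /\ 1 <= z t) ->
  forall t, a <= t -> P t <= x t.
Proof.
intros [Hx _] H1 t Ht.
assert (H : P t - P a <= x t - x a).
{ apply (derives_on_le a P (fun t => / p t) x (fun t => z t / p t)); auto; [|lra].
  intros r Hr; rewrite <- (Rmult_1_l (/ p r)); apply Rmult_le_compat_r.
  - now apply Rlt_le, Rinv_0_lt_compat, p_pos.
  - now apply H1. }
generalize (H1 a (Rle_refl a)); lra.
Qed.

(** The growing solution [x >= P] is unbounded, so if it is moderate then its
    quasi-derivative has a finite limit, which bounds [G] since [q x >= q P]. *)
Lemma integral_qP_of_all_moderate :
  all_solutions_moderate p q a -> exists l : R, is_lim G p_infty l.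
Proof.
intros Hall.
destruct (exists_growing_flow a p q) as [x [z [Hf H1]]]; auto.
assert (Hsol : solution p q a x z).
{ split; [now apply solves_of_flow; [apply p_neq_0|]|].
  exists a; generalize (H1 a (Rle_refl a)); split; lra. }
destruct (Hall a x z (Rle_refl a) Hsol) as [lx [lD [[Hlx HlD] Hm]]].
assert (Hinf : is_lim x p_infty p_infty).
{ apply (is_lim_le_p_loc P); [|exact P_lim].
  generalize (eventually_ge a); apply filter_imp; intros t Ht.
  now apply (P_le_growing x z). }
assert (Ex : lx = p_infty)
  by (rewrite <- (is_lim_unique _ _ _ Hlx); now apply is_lim_unique).
subst lx; destruct Hm as [[_ HD] | [[_ Habs] _]]; [|destruct Habs].
destruct lD as [l| |]; try (destruct HD as [_ []]).
apply (is_lim_bounded_incr a (l - z a + G a) G (fun t => q t * P t)); auto.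
{ exact qP_nonneg. }
intros t Ht.
assert (z t <= l).
{ apply (derives_on_incr_le_lim a l z (fun t => q t * x t)); auto.
  - apply Hf.
  - intros r Hr; apply Rmult_le_pos; [now apply q_nonneg|].
    generalize (H1 r Hr); lra. }
assert (G t - G a <= z t - z a).
{ apply (derives_on_le a G (fun t => q t * P t) z (fun t => q t * x t));
    auto; [apply Hf| |lra].
  intros r Hr; apply Rmult_le_compat_l; [now apply q_nonneg|].
  now apply (P_le_growing x z). }
lra.
Qed.

(** Eventually [P >= 1], and then [q <= q P]. *)
Lemma Q_lim_of_G_lim (l : R) :
  is_lim G p_infty l -> exists l' : R, is_lim Q p_infty l'.
Proof.
intros Hl; destruct (P_eventually 1) as [M HM].
(* [P >= 1] on [[b, oo)]. *)
set (b := Rmax a (M + 1)).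
assert (Hab : a <= b) by apply Rmax_l.
assert (HMb : M < b) by (generalize (Rmax_r a (M + 1)); unfold b; lra).
apply (is_lim_bounded_incr b (Q b + (l - G b)) Q q).
- now apply (derives_on_weaken a).
- intros r Hr; apply q_nonneg; lra.
- intros t Ht.
  assert (Q t - Q b <= G t - G b).
  { apply (derives_on_le b Q q G (fun t => q t * P t)).
    - now apply (derives_on_weaken a).
    - now apply (derives_on_weaken a).
    - intros r Hr; rewrite <- (Rmult_1_r (q r)) at 1.
      apply Rmult_le_compat_l; [apply q_nonneg; lra|].
      apply Rlt_le, HM; lra.
    - lra. }
  assert (G t <= l).
  { apply (derives_on_incr_le_lim a l G (fun t => q t * P t)); auto; [|lra].
    exact qP_nonneg. }
  lra.
Qed.

Lemma rho_eq (l t : R) : is_lim Q p_infty l -> a <= t -> rho q t = l - Q t.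
Proof. intros Hl Ht; now apply (int_to_infty_eq a l Q q). Qed.

(** Integration by parts: the derivative of [rho] is [- q]. *)
Lemma rho_over_p_primitive (l : R) :
  is_lim Q p_infty l ->
  exists K, derives_on a K (fun t => rho q t / p t) /\
    (integrable_at_infty (fun t => rho q t / p t) a <->
     exists l' : R, is_lim K p_infty l') /\
    (forall t, a <= t -> G t - G a = K t - K a - rho q t * P t).
Proof.
intros Hl.
assert (E : forall t, a <= t -> (l - Q t) * / p t = rho q t / p t)
  by (intros t Ht; now rewrite (rho_eq l)).
assert (Hder : derives_on a (fun t => l - Q t) (fun t => 0 - q t)).
{ apply (derives_on_minus a (fun _ => l) (fun _ => 0) Q q); auto.
  intros t _; apply (is_derive_const l). }
assert (Hc : continuous_on (fun t => a <= t) (fun t => rho q t / p t)).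
{ apply continuous_on_ext with (1 := E), continuous_on_mult.
  - apply derives_on_continuous with (1 := Hder).
  - apply continuous_on_inv; [exact p_cont | exact p_neq_0]. }
destruct (exists_primitive a _ Hc) as [K HK].
exists K; split; [exact HK|]; split.
- apply (integrable_at_infty_iff a); auto; lra.
- intros t Ht.
  assert (H : derives_on a (fun t => G t - (K t - (l - Q t) * P t)) (fun _ => 0)).
  { intros s Hs.
    replace 0 with (q s * P s - ((l - Q s) * / p s -
      ((0 - q s) * P s + (l - Q s) * / p s))) by ring.
    apply (is_derive_minus G (fun t => K t - (l - Q t) * P t)); [auto|].
    apply (is_derive_minus K (fun t => (l - Q t) * P t)).
    - rewrite E by easy; now apply HK.
    - apply (is_derive_mult (fun t => l - Q t) P); auto.
      intros; apply Rmult_comm. }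
  destruct (derives_on_mean a _ _ a t H) as [c [_ Hc']]; [lra|].
  rewrite P_start in Hc'; rewrite (rho_eq l) by easy; lra.
Qed.

Lemma rho_nonneg (l t : R) : is_lim Q p_infty l -> a <= t -> 0 <= rho q t.
Proof.
intros Hl Ht; rewrite (rho_eq l) by easy.
generalize (derives_on_incr_le_lim a l Q q t Q_derive q_nonneg Hl Ht); lra.
Qed.

(** By parts, [G] and a primitive of [rho / p] differ by [rho P] and a constant.
    This term is nonnegative, which gives one direction; and as [P] increases,
    it is at most the tail of the integral of [q P], which gives the other. *)
Lemma integral_qP_iff_rho_condition :
  (exists l : R, is_lim G p_infty l) <-> rho_condition p q a.
Proof.
unfold rho_condition.
rewrite (integrable_at_infty_iff a Q q a q_cont Q_derive (Rle_refl a)).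
split.
- intros [l Hl]; destruct (Q_lim_of_G_lim l Hl) as [l' Hl'].
  split; [now exists l'|].
  destruct (rho_over_p_primitive l' Hl') as [K [HK [HiffK HG]]]; apply HiffK.
  apply (is_lim_bounded_incr a (l - G a + K a) K (fun t => rho q t / p t)); auto.
  { intros t Ht; apply Rmult_le_pos; [now apply (rho_nonneg l')|].
    now apply Rlt_le, Rinv_0_lt_compat, p_pos. }
  intros t Ht; generalize (HG t Ht).
  (* Let [s] tend to infinity in [(Q s - Q t) P t <= G s - G t]. *)
  assert (rho q t * P t <= l - G t); [|lra].
  rewrite (rho_eq l') by easy.
  apply (is_lim_le_bound (fun s => (Q s - Q t) * P t)).
  + apply (is_lim_scal_r (fun s => Q s - Q t) (P t) p_infty (l' - Q t)).
    apply (is_lim_minus' Q (fun _ => Q t)); [exact Hl' | apply is_lim_const].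
  + generalize (eventually_ge t); apply filter_imp; intros s Hs.
    assert (Hd : P t * Q s - P t * Q t <= G s - G t).
    { apply (derives_on_le t (fun s => P t * Q s) (fun s => P t * q s)
        G (fun t => q t * P t)).
      - intros r Hr; apply (is_derive_scal Q), Q_derive; lra.
      - now apply (derives_on_weaken a).
      - intros r Hr; rewrite Rmult_comm; apply Rmult_le_compat_l.
        + apply q_nonneg; lra.
        + apply (derives_on_incr a P (fun t => / p t)); [auto| |lra].
          intros w Hw; now apply Rlt_le, Rinv_0_lt_compat, p_pos.
      - lra. }
    assert (G s <= l).
    { apply (derives_on_incr_le_lim a l G (fun t => q t * P t)); auto; [|lra].
      exact qP_nonneg. }
    lra.
- intros [[l Hl] Hi].
  destruct (rho_over_p_primitive l Hl) as [K [HK [HiffK HG]]].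
  destruct (proj1 HiffK Hi) as [k Hk].
  apply (is_lim_bounded_incr a (k - K a + G a) G (fun t => q t * P t)); auto.
  { exact qP_nonneg. }
  intros t Ht; generalize (HG t Ht).
  assert (0 <= rho q t * P t)
    by (apply Rmult_le_pos; [now apply (rho_nonneg l) | now apply P_nonneg]).
  assert (K t <= k); [|lra].
  apply (derives_on_incr_le_lim a k K (fun t => rho q t / p t)); auto.
  intros r Hr; apply Rmult_le_pos; [now apply (rho_nonneg l)|].
  now apply Rlt_le, Rinv_0_lt_compat, p_pos.
Qed.

(** Since [z] increases, [x <= x(a) + z P]; therefore
    [(ln z)' = q x / z <= x(a) q + q P], which is integrable. *)
Lemma growing_flow_quasi_derivative_bounded (l : R) (x z : R -> R) :
  is_lim G p_infty l -> flow p q a x z ->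
  (forall t, a <= t -> 1 <= x t /\ 1 <= z t) ->
  exists m : R, is_lim z p_infty m.
Proof.
intros Hl Hf H1; destruct (Q_lim_of_G_lim l Hl) as [l' Hl'].
(* The derivative of [z P] is [z / p + q x P], at least that of [x]. *)
assert (Hxz : forall t, a <= t -> x t <= x a + z t * P t).
{ intros t Ht.
  assert (H : x t - x a <= z t * P t - z a * P a).
  { apply (derives_on_le a x (fun t => z t / p t) (fun t => z t * P t)
      (fun t => q t * x t * P t + z t * / p t)); [apply Hf| | |lra].
    - intros s Hs; apply (is_derive_mult z P); [now apply Hf | auto |].
      intros; apply Rmult_comm.
    - intros r Hr.
      assert (0 <= q r * x r * P r); [|unfold Rdiv; lra].
      apply Rmult_le_pos; [apply Rmult_le_pos|].
      + now apply q_nonneg.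
      + generalize (H1 r Hr); lra.
      + now apply P_nonneg. }
  rewrite P_start in H; lra. }
apply (is_lim_bounded_incr a (exp (ln (z a) + x a * (l' - Q a) + (l - G a)))
  z (fun t => q t * x t)).
- apply Hf.
- intros r Hr; apply Rmult_le_pos; [now apply q_nonneg | generalize (H1 r Hr); lra].
- intros t Ht.
  assert (Hd : ln (z t) - ln (z a) <= x a * Q t + G t - (x a * Q a + G a)).
  { apply (derives_on_le a (fun t => ln (z t)) (fun t => q t * x t * / z t)
      (fun t => x a * Q t + G t) (fun t => x a * q t + q t * P t)); [| | |lra].
    - intros s Hs; apply (is_derive_comp ln z).
      + apply is_derive_ln; generalize (H1 s Hs); lra.
      + now apply Hf.
    - intros s Hs; apply (is_derive_plus (fun t => x a * Q t) G); [|auto].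
      now apply (is_derive_scal Q), Q_derive.
    - intros r Hr; generalize (H1 r Hr); intros [Hxr Hzr].
      replace (x a * q r + q r * P r) with (q r * (x a + P r)) by ring.
      rewrite Rmult_assoc; apply Rmult_le_compat_l; [now apply q_nonneg|].
      apply (Rmult_le_reg_r (z r)); [lra|].
      rewrite Rmult_assoc, Rinv_l, Rmult_1_r by lra.
      apply Rle_trans with (1 := Hxz r Hr).
      generalize (H1 a (Rle_refl a)); intros [Hxa _].
      assert (x a * 1 <= x a * z r) by (apply Rmult_le_compat_l; lra).
      lra. }
  assert (x a * Q t <= x a * l').
  { apply Rmult_le_compat_l; [generalize (H1 a (Rle_refl a)); lra|].
    apply (derives_on_incr_le_lim a l' Q q); auto; exact q_nonneg. }
  assert (G t <= l).
  { apply (derives_on_incr_le_lim a l G (fun t => q t * P t)); auto.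
    exact qP_nonneg. }
  rewrite <- (exp_ln (z t)) by (generalize (H1 t Ht); lra).
  match goal with |- exp ?u <= exp ?v =>
    assert (Huv : u <= v) by lra; destruct Huv as [Huv | ->] end.
  + now apply Rlt_le, exp_increasing.
  + apply Rle_refl.
Qed.

Lemma exists_dominant_flow (l : R) :
  is_lim G p_infty l ->
  exists x z, flow p q a x z /\
    (forall t, a <= t -> 0 < x t) /\ (forall t, a <= t -> 0 < z t) /\
    is_lim z p_infty 1 /\ is_lim (fun t => x t / P t) p_infty 1 /\
    is_lim x p_infty p_infty.
Proof.
intros Hl.
destruct (exists_growing_flow a p q) as [y [w [Hf H1]]]; auto.
destruct (growing_flow_quasi_derivative_bounded l y w Hl Hf H1) as [m Hm].
assert (Hm1 : 1 <= m).
{ apply (is_lim_ge_bound w m 1 Hm).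
  generalize (eventually_ge a); apply filter_imp; intros t Ht; now apply H1. }
assert (Hm0 : 0 < / m) by (apply Rinv_0_lt_compat; lra).
exists (fun t => / m * y t), (fun t => / m * w t).
assert (Hlim : is_lim (fun t => / m * w t) p_infty 1).
{ replace 1 with (/ m * m) by (field; lra).
  apply (is_lim_scal_l w (/ m) p_infty m Hm). }
split; [now apply flow_scal|]; split; [|split; [|split; [exact Hlim|split]]].
- intros t Ht; apply Rmult_lt_0_compat; [exact Hm0 | generalize (H1 t Ht); lra].
- intros t Ht; apply Rmult_lt_0_compat; [exact Hm0 | generalize (H1 t Ht); lra].
- apply (lhopital_infty a 1 _ P (fun t => / p t) (fun t => / m * w t)); auto.
  + apply derives_on_ext with (2 := proj1 (flow_scal p q a (/ m) y w Hf)).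
    intros t Ht; unfold Rdiv; ring.
  + intros t Ht; now apply Rinv_0_lt_compat, p_pos.
- apply (is_lim_le_p_loc (fun t => / m * P t)).
  + generalize (eventually_ge a); apply filter_imp; intros t Ht.
    apply Rmult_le_compat_l; [lra | now apply (P_le_growing y w)].
  + apply is_lim_spec; intros M.
    generalize (P_eventually (m * M)); apply filter_imp; intros t Ht.
    apply (Rmult_lt_reg_l m); [lra|].
    rewrite <- Rmult_assoc, Rinv_r, Rmult_1_l by lra; exact Ht.
Qed.

(** Reduction of order: [x1 = x2 J] with [J(t) = int_t^oo 1 / (p x2^2)].  The
    integral converges because [1 / (p x2^2)] is at most a constant times
    [z2 / (p x2^2)], the derivative of [- 1 / x2].  Moreover
    [Dx1 = z2 J - 1 / x2], which makes the Wronskian equal to [1] identically,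
    and [x1 = J / (1 / x2)] is a quotient of two functions tending to [0] whose
    derivatives have ratio [1 / z2]. *)
Lemma exists_recessive_flow (x2 z2 : R -> R) :
  flow p q a x2 z2 ->
  (forall t, a <= t -> 0 < x2 t) -> (forall t, a <= t -> 0 < z2 t) ->
  is_lim z2 p_infty 1 -> is_lim x2 p_infty p_infty ->
  exists x1 z1, flow p q a x1 z1 /\
    (forall t, a <= t -> 0 < x1 t) /\ (forall t, a <= t -> z1 t < 0) /\
    (forall t, a <= t -> x1 t * z2 t - x2 t * z1 t = 1) /\
    is_lim x1 p_infty 1 /\ is_lim z1 p_infty 0.
Proof.
intros Hf Hx2 Hz2 Hz2l Hx2l.
assert (Hx0 : forall t, a <= t -> x2 t <> 0)
  by (intros t Ht; generalize (Hx2 t Ht); lra).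
assert (Hz0 : forall t, a <= t -> z2 t <> 0)
  by (intros t Ht; generalize (Hz2 t Ht); lra).
assert (Hd : forall t, a <= t -> 0 < / p t * (/ x2 t * / x2 t)).
{ intros t Ht; apply Rmult_lt_0_compat; [now apply Rinv_0_lt_compat, p_pos|].
  apply Rmult_lt_0_compat; now apply Rinv_0_lt_compat, Hx2. }
destruct (exists_primitive a (fun t => / p t * (/ x2 t * / x2 t))) as [F HF].
{ assert (continuous_on (fun t => a <= t) (fun t => / x2 t)).
  { apply continuous_on_inv; [|exact Hx0]; eapply derives_on_continuous, Hf. }
  apply continuous_on_mult; [|now apply continuous_on_mult].
  apply continuous_on_inv; [exact p_cont | exact p_neq_0]. }
(* This derivative is the integrand of [J] times [z2]: it serves both to bound
   that integral and as the comparison function in L'Hopital's rule. *)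
assert (Hinv : derives_on a (fun t => - / x2 t)
  (fun t => / p t * (/ x2 t * / x2 t) * z2 t)).
{ intros t Ht.
  replace (/ p t * (/ x2 t * / x2 t) * z2 t)
    with (- (- (z2 t / p t) / x2 t ^ 2))
    by (field; auto using p_neq_0).
  apply (is_derive_opp (fun t => / x2 t)), is_derive_inv; [now apply Hf | auto]. }
assert (Hinvl : is_lim (fun t => / x2 t) p_infty 0)
  by (apply (is_lim_inv x2 p_infty p_infty); easy).
assert (Hoppl : is_lim (fun t => - / x2 t) p_infty 0).
{ replace (Finite 0) with (Rbar_opp 0) by (simpl; f_equal; ring).
  now apply is_lim_opp. }
destruct (is_lim_bounded_incr a (F a + / z2 a * / x2 a) F
  (fun t => / p t * (/ x2 t * / x2 t))) as [l Hl]; auto.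
{ intros r Hr; now apply Rlt_le, Hd. }
{ intros t Ht.
  assert (Hle : F t - F a <= / z2 a * - / x2 t - / z2 a * - / x2 a).
  { apply (derives_on_le a F (fun t => / p t * (/ x2 t * / x2 t))
      (fun t => / z2 a * - / x2 t)
      (fun t => / z2 a * (/ p t * (/ x2 t * / x2 t) * z2 t))); [exact HF| | |lra].
    - intros s Hs; now apply (is_derive_scal (fun t => - / x2 t)), Hinv.
    - intros r Hr; apply Rle_trans
        with (/ p r * (/ x2 r * / x2 r) * (/ z2 a * z2 r)); [|lra].
      rewrite <- (Rmult_1_r (/ p r * (/ x2 r * / x2 r))) at 1.
      apply Rmult_le_compat_l; [now apply Rlt_le, Hd|].
      apply (Rmult_le_reg_l (z2 a)); [apply Hz2; lra|].
      rewrite <- Rmult_assoc, Rinv_r, Rmult_1_l, Rmult_1_r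
        by (apply Hz0; lra).
      apply (flow_growing x2 z2 Hf); auto.
      intros s Hs; now apply Rlt_le, Hx2. }
  assert (0 < / z2 a * / x2 t).
  { apply Rmult_lt_0_compat; apply Rinv_0_lt_compat; [apply Hz2; lra | auto]. }
  lra. }
assert (HJ : derives_on a (fun t => l - F t)
  (fun t => 0 - / p t * (/ x2 t * / x2 t))).
{ apply (derives_on_minus a (fun _ => l) (fun _ => 0)); [|exact HF].
  intros t _; apply (is_derive_const l). }
assert (HJl : is_lim (fun t => l - F t) p_infty 0).
{ replace 0 with (l - l) by ring.
  apply (is_lim_minus' (fun _ => l) F); [apply is_lim_const | exact Hl]. }
exists (fun t => x2 t * (l - F t)), (fun t => z2 t * (l - F t) + - / x2 t).
assert (Hx1 : forall t, a <= t -> 0 < x2 t * (l - F t)).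
{ intros t Ht; apply Rmult_lt_0_compat; [auto|].
  generalize (derives_on_strict_incr_lt_lim a l F _ t HF Hd Hl Ht); lra. }
assert (Hflow : flow p q a (fun t => x2 t * (l - F t))
  (fun t => z2 t * (l - F t) + - / x2 t)).
{ split; intros t Ht.
  - replace ((z2 t * (l - F t) + - / x2 t) / p t)
      with (z2 t / p t * (l - F t) + x2 t * (0 - / p t * (/ x2 t * / x2 t)))
      by (field; auto using p_neq_0).
    apply (is_derive_mult x2 (fun t => l - F t)); [now apply Hf | now apply HJ|].
    intros; apply Rmult_comm.
  - replace (q t * (x2 t * (l - F t)))
      with (q t * x2 t * (l - F t) + z2 t * (0 - / p t * (/ x2 t * / x2 t))
            + / p t * (/ x2 t * / x2 t) * z2 t) by ring.
    apply (is_derive_plus (fun t => z2 t * (l - F t))); [|now apply Hinv].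
    apply (is_derive_mult z2 (fun t => l - F t)); [now apply Hf | now apply HJ|].
    intros; apply Rmult_comm. }
assert (Hz1l : is_lim (fun t => z2 t * (l - F t) + - / x2 t) p_infty 0).
{ replace 0 with (1 * 0 + 0) by ring.
  apply (is_lim_plus' (fun t => z2 t * (l - F t))); [|exact Hoppl].
  now apply (is_lim_mult z2 (fun t => l - F t) p_infty 1 0). }
split; [exact Hflow|]; split; [exact Hx1|]; split; [|split; [|split; [|exact Hz1l]]].
- intros t Ht.
  apply (derives_on_strict_incr_lt_lim a 0 _ _ t (proj2 Hflow)); auto.
  intros r Hr; apply Rmult_lt_0_compat; auto.
- intros t Ht; field; now apply Hx0.
- apply (is_lim_ext_loc (fun t => (F t - l) / - / x2 t)).
  { generalize (eventually_ge a); apply filter_imp; intros t Ht.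
    field; now apply Hx0. }
  apply (lhopital_zero a 1 _ _ (fun t => / p t * (/ x2 t * / x2 t) * z2 t)
    (fun t => / z2 t)).
  + apply derives_on_ext with (fun t => / p t * (/ x2 t * / x2 t) - 0).
    { intros t Ht; field; auto using p_neq_0. }
    apply (derives_on_minus a F _ (fun _ => l) (fun _ => 0)); [exact HF|].
    intros t _; apply (is_derive_const l).
  + exact Hinv.
  + intros t Ht; apply Rmult_lt_0_compat; auto.
  + replace 0 with (l - l) by ring.
    apply (is_lim_minus' F (fun _ => l)); [exact Hl | apply is_lim_const].
  + exact Hoppl.
  + replace (Finite 1) with (Rbar_inv 1) by (simpl; f_equal; field).
    apply is_lim_inv; [exact Hz2l|].
    intros H; injection H; lra.
Qed.

(** Both [Dx1] and [- rho] tend to [0], with derivatives [q x1] and [q]. *)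
Lemma recessive_quasi_derivative_asymp (l : R) (x1 z1 : R -> R) :
  is_lim G p_infty l -> flow p q a x1 z1 ->
  is_lim x1 p_infty 1 -> is_lim z1 p_infty 0 -> asymp z1 (fun t => - rho q t).
Proof.
intros Hl [_ Hz] Hx1 Hz1; destruct (Q_lim_of_G_lim l Hl) as [l' Hl'].
apply (is_lim_ext_loc (fun t => z1 t / (Q t - l'))).
{ generalize (eventually_ge a); apply filter_imp; intros t Ht.
  rewrite (rho_eq l') by easy; f_equal; ring. }
apply (lhopital_zero a 1 z1 (fun t => Q t - l') q x1); auto.
- apply derives_on_ext with (fun t => q t - 0); [intros; ring|].
  apply (derives_on_minus a Q q (fun _ => l') (fun _ => 0)); [auto|].
  intros t _; apply (is_derive_const l').
- replace 0 with (l' - l') by ring.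
  apply (is_lim_minus' Q (fun _ => l')); [exact Hl' | apply is_lim_const].
Qed.

End Equation.

(** * The characterization *)

Theorem theorem3p2 (a : R) (p q : R -> R)
    (ha : 0 <= a)
    (p_cont : continuous_on (fun t => a <= t) p)
    (q_cont : continuous_on (fun t => a <= t) q)
    (p_pos : forall t, a <= t -> 0 < p t)
    (q_pos : forall t, a <= t -> 0 < q t)
    (p_div : is_lim (fun t => RInt (fun s => / p s) a t) p_infty p_infty) :
  (all_solutions_moderate p q a <->
     integrable_at_infty (fun t => q t * Pint p a t) a) /\
  (integrable_at_infty (fun t => q t * Pint p a t) a <-> rho_condition p q a) /\
  (integrable_at_infty (fun t => q t * Pint p a t) a ->
     exists x1 Dx1 x2 Dx2 : R -> R,
       moderate_basis p q a x1 Dx1 x2 Dx2 /\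
       (reproduced_from_R1 p q a x1 /\ reproduced_from_R1 p q a x2) /\
       (reproduced_from_R2 p q a x1 /\ reproduced_from_R2 p q a x2) /\
       asymp x1 (fun _ => 1) /\ asymp Dx1 (fun t => - rho q t) /\
       asymp x2 (fun t => Pint p a t) /\ asymp Dx2 (fun _ => 1)).
Proof.
assert (p_neq : forall t, a <= t -> p t <> 0) by now apply p_neq_0.
assert (Hc : continuous_on (fun t => a <= t) (fun t => / p t))
  by now apply continuous_on_inv.
destruct (exists_primitive a (fun t => / p t) Hc) as [P0 HP0].
set (P := fun t => P0 t - P0 a).
assert (HP : derives_on a P (fun t => / p t)).
{ apply derives_on_ext with (fun t => / p t - 0); [intros; ring|].
  apply (derives_on_minus a P0 _ (fun _ => P0 a) (fun _ => 0)); [exact HP0|].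
  intros t _; apply (is_derive_const (P0 a)). }
assert (P_start : P a = 0) by (unfold P; ring).
assert (EP : forall t, a <= t -> P t = Pint p a t).
{ intros t Ht; symmetry; apply is_RInt_unique.
  now apply (is_RInt_primitive a P0); [| |apply Rle_refl|]. }
assert (P_lim : is_lim P p_infty p_infty).
{ apply is_lim_ext_loc with (2 := p_div).
  generalize (eventually_ge a); apply filter_imp; intros t Ht.
  symmetry; now apply EP. }
destruct (exists_primitive a q q_cont) as [Q HQ].
assert (EqP : forall t, a <= t -> q t * P t = q t * Pint p a t)
  by (intros t Ht; now rewrite EP).
assert (HqPc : continuous_on (fun t => a <= t) (fun t => q t * Pint p a t)).
{ apply continuous_on_ext with (1 := EqP), continuous_on_mult; [exact q_cont|].
  now apply derives_on_continuous with (1 := HP). }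
destruct (exists_primitive a _ HqPc) as [G HG].
assert (HG' : derives_on a G (fun t => q t * P t))
  by (apply derives_on_ext with (2 := HG); intros; symmetry; auto).
rewrite (integrable_at_infty_iff a G _ a HqPc HG (Rle_refl a)).
assert (Hbasis : forall l : R, is_lim G p_infty l ->
  exists x1 z1 x2 z2, flow p q a x1 z1 /\ flow p q a x2 z2 /\
    ((forall t, a <= t -> 0 < x1 t) /\ (forall t, a <= t -> z1 t < 0) /\
     (forall t, a <= t -> 0 < x2 t) /\ (forall t, a <= t -> 0 < z2 t)) /\
    (forall t, a <= t -> x1 t * z2 t - x2 t * z1 t = 1) /\
    is_lim x1 p_infty 1 /\ is_lim z1 p_infty 0 /\
    is_lim x2 p_infty p_infty /\ is_lim z2 p_infty 1 /\
    is_lim (fun t => x2 t / P t) p_infty 1).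
{ intros l Hl.
  destruct (exists_dominant_flow a p q p_cont q_cont p_pos q_pos P Q G
    P_start HP P_lim HQ HG' l Hl) as [x2 [z2 [Hf2 [Hx2 [Hz2 [Hz2l [HxP Hx2l]]]]]]].
  destruct (exists_recessive_flow a p q p_cont p_pos q_pos x2 z2
    Hf2 Hx2 Hz2 Hz2l Hx2l) as [x1 [z1 [Hf1 [Hx1 [Hz1 [HW [Hx1l Hz1l]]]]]]].
  exists x1, z1, x2, z2; tauto. }
split; [split|split].
- now apply (integral_qP_of_all_moderate a p q) with (P := P).
- intros [l Hl] T x Dx HaT [Hs Hnz].
  destruct (Hbasis l Hl) as
    [x1 [z1 [x2 [z2 [Hf1 [Hf2 [_ [HW [Hx1 [Hz1 [Hx2 [Hz2 _]]]]]]]]]]]].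
  destruct (solves_span p q a x1 z1 x2 z2 p_neq Hf1 Hf2 HW T x Dx HaT Hs)
    as [c1 [c2 E]].
  now apply (moderate_of_combination T c1 c2 x1 z1 x2 z2).
- now apply (integral_qP_iff_rho_condition a p q) with (P := P) (Q := Q).
- intros [l Hl].
  destruct (Hbasis l Hl) as
    [x1 [z1 [x2 [z2 [Hf1 [Hf2 [[P1 [P2 [P3 P4]]] [HW [Hx1 [Hz1 [Hx2 [Hz2 HxP]]]]]]]]]]]].
  assert (Ha : a <= a) by apply Rle_refl.
  assert (Hsol1 : solution p q a x1 z1).
  { split; [now apply solves_of_flow|].
    exists a; split; [exact Ha|]; generalize (P1 a Ha); lra. }
  assert (Hsol2 : solution p q a x2 z2).
  { split; [now apply solves_of_flow|].
    exists a; split; [exact Ha|]; generalize (P3 a Ha); lra. }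
  exists x1, z1, x2, z2; split; [split; [split; [exact Hsol1|split; [exact Hsol2|]]|]|].
  + intros T HaT; split.
    * intros c1 c2 H0.
      (* [x1] decreases and [x2] increases, by the signs of [z1] and [z2]. *)
      apply (monotone_independent T c1 c2 x1 x2); [split|split|exact H0].
      -- apply P1; lra.
      -- assert (- x1 T <= - x1 (T + 1)); [|lra].
         apply (derives_on_incr a (fun t => - x1 t) (fun t => - (z1 t / p t)));
           [| |lra].
         ++ intros r Hr; apply (is_derive_opp x1); now apply Hf1.
         ++ intros r Hr; generalize (P2 r Hr); intros Hneg.
            replace (- (z1 r / p r)) with (- z1 r * / p r) by (unfold Rdiv; ring).
            apply Rmult_le_pos; [lra | now apply Rlt_le, Rinv_0_lt_compat, p_pos].
      -- now apply P3.
      -- apply (derives_on_strict_incr a x2 (fun t => z2 t / p t)); [apply Hf2| |lra].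
         intros r Hr; now apply Rdiv_lt_0_compat; [apply P4 | apply p_pos].
    * intros x Dx Hs.
      destruct (solves_span p q a x1 z1 x2 z2 p_neq Hf1 Hf2 HW T x Dx HaT Hs)
        as [c1 [c2 E]].
      exists c1, c2; intros t Ht; now apply E.
  + split.
    * apply (moderate_of_combination a 1 0 x1 z1 x2 z2); auto; [|apply Hsol1].
      intros t _; split; ring.
    * apply (moderate_of_combination a 0 1 x1 z1 x2 z2); auto; [|apply Hsol2].
      intros t _; split; ring.
  + split; [split|split; [split|split; [|split; [|split]]]].
    * now apply (reproduced_from_R1_of_flow p q a x1 z1).
    * now apply (reproduced_from_R1_of_flow p q a x2 z2).
    * apply (reproduced_from_R2_of_flow p q a x1 z1); auto.
      intros t Ht; generalize (P2 t Ht); lra.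
    * apply (reproduced_from_R2_of_flow p q a x2 z2); auto.
      intros t Ht; generalize (P4 t Ht); lra.
    * apply is_lim_ext with (2 := Hx1); intros t; field.
    * now apply (recessive_quasi_derivative_asymp a p q) with (P := P) (Q := Q)
        (G := G) (l := l) (x1 := x1).
    * apply is_lim_ext_loc with (2 := HxP).
      generalize (eventually_ge a); apply filter_imp; intros t Ht.
      now rewrite EP.
    * apply is_lim_ext with (2 := Hz2); intros t; field.
Qed.
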